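(* Let $\alpha,\beta,M_f,M_V>0$. Consider the regression model $y_i=f(x_i)+V^{1/2}(x_i)z_i$, $i=1,\ldots,n$, where $x_i=i/n$ and $z_1,\ldots,z_n$ are i.i.d. $N(0,1)$. Then there is a constant $C_1>0$ depending only on $\alpha,\beta,M_f$ and $M_V$ such that $$\inf_{\widehat V}\ \sup_{f\in\Lambda^\alpha(M_f),\,V\in\Lambda^\beta(M_V)}E\|\widehat V-V\|_2^2\ \ge\ C_1\cdot\max\{n^{-4\alpha},n^{-2\beta/(1+2\beta)}\}$$ and, for any fixed $x_*\in(0,1)$, $$\inf_{\widehat V}\ \sup_{f\in\Lambda^\alpha(M_f),\,V\in\Lambda^\beta(M_V)}E\big(\widehat V(x_* )-V(x_* )\big)^2\ \ge\ C_1\cdot\max\{n^{-4\alpha},n^{-2\beta/(1+2\beta)}\},$$ where the infima are over all estimators $\widehat V$ of $V$ based on the observations $y_1,\ldots,y_n$.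
   Context: The mean function $f$ and the variance function $V\ge0$ are defined on $[0,1]$ and unknown (the supremum over $V$ is over nonnegative functions in the class); $E$ denotes expectation under the model with the given $f$ and $V$. $\|g\|_2^2=\int_0^1g(x)^2\,dx$. Lipschitz class. For $\alpha>0$, $M>0$, let $\lfloor\alpha\rfloor$ denote the largest integer strictly less than $\alpha$ and $\alpha'=\alpha-\lfloor\alpha\rfloor$. Then $\Lambda^\alpha(M)$ is the set of functions $g:[0,1]\to\mathbb{R}$ such that for all $0\le x,y\le1$ and $k=0,\ldots,\lfloor\alpha\rfloor-1$, $|g^{(k)}(x)|\le M$ and $|g^{(\lfloor\alpha\rfloor)}(x)-g^{(\lfloor\alpha\rfloor)}(y)|\le M|x-y|^{\alpha'}$. *)

(* Defs.v *)
From HB Require Import structures.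
From mathcomp Require Import all_boot all_order all_algebra.
From mathcomp Require Import all_classical all_reals all_analysis.
Import Order.TTheory GRing.Theory Num.Theory.
Import numFieldNormedType.Exports.

Set Implicit Arguments.
Unset Strict Implicit.
Unset Printing Implicit Defensive.

Local Open Scope classical_set_scope.
Local Open Scope ring_scope.

(* Functions on [0, 1] are represented by total functions R -> R; no
   definition below depends on their values outside [0, 1]. *)

Section Lipschitz_class.
Context {R : realType}.
Implicit Types (g : R -> R) (a M x : R).

(* [dquot g x @ nbhs01 x] converges iff g is differentiable at x as a function
   on [0, 1], that is, with one-sided derivatives at 0 and 1. *)
Definition nbhs01 x : set_system R := within `[0, 1] (dnbhs x).

Definition dquot g x : R -> R := fun y => (g y - g x) / (y - x).

Definition derivable01 g : Prop :=
  forall x, x \in `[0, 1] -> cvg (dquot g x @ nbhs01 x).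

Definition deriv01 g : R -> R := fun x => lim (dquot g x @ nbhs01 x).

Definition nderiv01 (k : nat) g : R -> R := iter k deriv01 g.

(* The largest integer STRICTLY less than a, for a > 0 (so 0 for a = 1). *)
Definition sfloor a : nat := `|Num.ceil a - 1|%N.

Lemma sfloor_itv a : 0 < a -> (sfloor a)%:R < a <= (sfloor a).+1%:R.
Proof.
move=> a0; have c0 : 0 <= Num.ceil a - 1.
  by rewrite subr_ge0 -gtz0_ge1 ceil_gt0.
have := ceil_itv a; rewrite /sfloor -natr1 !natr_absz ger0_norm //.
by rewrite rmorphB /= subrK.
Qed.

Definition Lipschitz_class a M : set (R -> R) := [set g |
  [/\ forall k, (k < sfloor a)%N -> derivable01 (nderiv01 k g),
      forall k x, (k < sfloor a)%N -> x \in `[0, 1] -> `|nderiv01 k g x| <= M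
    & forall x y, x \in `[0, 1] -> y \in `[0, 1] ->
        `|nderiv01 (sfloor a) g x - nderiv01 (sfloor a) g y|
          <= M * `|x - y| `^ (a - (sfloor a)%:R)] ].

End Lipschitz_class.

Section regression_model.
Context d (T : measurableType d) (R : realType) (P : probability T R).
Local Open Scope ereal_scope.

Definition mutually_independent (I : finType) (X : I -> {RV P >-> R}) : Prop :=
  forall (J : {set I}) (A : I -> set R), (forall i, measurable (A i)) ->
    P (\bigcap_(i in [set` J]) X i @^-1` A i) =
    \prod_(i in J) P (X i @^-1` A i).

Definition iid_std_normal (n : nat) (z : 'I_n -> {RV P >-> R}) : Prop :=
  mutually_independent z /\
  forall i (A : set R), measurable A ->
    distribution P (z i) A = normal_prob 0%R 1%R A.

Variables (n : nat) (z : 'I_n -> {RV P >-> R}).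

(* Ordinals start at 0, so the i-th design point is (i + 1) / n. *)
Definition design (i : 'I_n) : R := (i.+1%:R / n%:R)%R.

Definition observations (f V : R -> R) (w : T) : n.-tuple R :=
  [tuple (f (design i) + Num.sqrt (V (design i)) * z i w)%R | i < n].

(* An estimator maps the data y and a point x to the value at x of the
   estimated variance function. *)
Definition estimators : set (n.-tuple R -> R -> R) :=
  [set Vhat | measurable_fun [set p : n.-tuple R * R | p.2 \in `[0%R, 1%R]]
                (fun p => Vhat p.1 p.2)].

Definition sqnorm2 (g : R -> R) : \bar R :=
  \int[lebesgue_measure]_(x in `[0%R, 1%R]) ((g x) ^+ 2)%:E.

Definition global_risk (Vhat : n.-tuple R -> R -> R) (f V : R -> R) : \bar R :=
  \int[P]_w sqnorm2 (fun x => Vhat (observations f V w) x - V x)%R.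

Definition pointwise_risk (xs : R) (Vhat : n.-tuple R -> R -> R)
    (f V : R -> R) : \bar R :=
  \int[P]_w (((Vhat (observations f V w) xs - V xs) ^+ 2)%R)%:E.

End regression_model.

Section minimax.
Context {R : realType}.

Definition parameters (a b Mf MV : R) : set ((R -> R) * (R -> R)) :=
  [set p | [/\ Lipschitz_class a Mf p.1, Lipschitz_class b MV p.2
             & forall x, x \in `[0, 1] -> 0 <= p.2 x] ].

Definition minimax (n : nat) (Theta : set ((R -> R) * (R -> R)))
    (risk : (n.-tuple R -> R -> R) -> (R -> R) -> (R -> R) -> \bar R) : \bar R :=
  ereal_inf [set ereal_sup [set risk Vhat p.1 p.2 | p in Theta]
            | Vhat in @estimators R n].

End minimax.

(* Main.v *)
(* Both rates come from comparing two laws of the data through the inequality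
   Q1(A)^2 <= K Q0(A), which tensorizes: if (int g dnu1)^2 <= K_i int g^2 dnu0
   holds on each coordinate (a chi-square bound), Fubini gives it for the product
   laws with K the product of the K_i, and then
   E0 (t - v0)^2 + E1 (t - v1)^2 >= (v0 - v1)^2 / (8 K) for every estimator t.

   For n^(-2b/(1+2b)), f = 0 and V is a constant plus bumps of width 1/m and
   height of order m^-b, where m is of order n^(1/(1+2b)), switched on or off by
   independent bits; flipping one bit changes about n/m observations, by a
   relative amount m^-b each.

   For n^(-4a), which matters only when a <= 1, f takes independent random values
   of order n^-a at the design points, drawn from one of two discrete
   distributions, while V is constant and the two values of V differ by an amount
   of order n^(-2a). A Vandermonde system provides distributions for which the two
   mixed laws of an observation agree up to moments of order q, so that their
   chi-square distance is O(n^(-2a(q+1))) = O(1/n) once q + 1 >= 1/a. *)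

From HB Require Import structures.
Require Import Defs.
From mathcomp Require Import all_boot all_order all_algebra.
From mathcomp Require Import all_classical all_reals all_analysis.
From mathcomp Require Import measurable_realfun.
From mathcomp Require Import zify ring lra.
Import Order.TTheory GRing.Theory Num.Theory.
Import numFieldNormedType.Exports.
Set Implicit Arguments.
Unset Strict Implicit.
Unset Printing Implicit Defensive.
Local Open Scope classical_set_scope.
Local Open Scope ring_scope.

(** * Bump functions and the Lipschitz classes *)

(** The bumps are polynomials precomposed with truncation to [0, 1]. Such a function is as smooth as
    the order of the zeros of the polynomial at 0 and 1 allows, and its derivatives keep the same
    form, so membership in a Lipschitz class reduces to polynomial estimates. Adjacent bumps do not
    overlap, so all bounds are uniform in their number.

    In the construction with a random mean, the obstacle is that the larger variance multiplies the
    likelihood ratio against N(0, s^2) by exp(eta t^2 / 2), t = a y / s, and the smaller variance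
    has to imitate this by its mixing weights alone, which must be positive. At eta = 0 the
    Vandermonde system is solved by weights all equal to 1, and its solution is polynomial in eta,
    so a small fixed eta works. The gap between the two variances is then of order eta a^2.

    Each bound is first proved for the average risk under a finite prior. For the integrated risk
    the same prior has to serve every x, so that the pointwise bounds can be integrated by
    Tonelli. *)

Section polynomials_on_unit_interval.
Context {R : realType}.
Implicit Types (p : {poly R}) (x y : R).

(** Induction along Horner's rule p X + c. The bounds on values and first derivatives feed the
    bounds on increments, so one constant carries all four through the induction. *)
Lemma poly_unit_bounds p : exists2 C : R, 0 <= C & forall x y,
  0 <= x <= 1 -> 0 <= y <= 1 ->
  [/\ `|p.[x]| <= C, `|p^`().[x]| <= C, `|p.[y] - p.[x]| <= C * `|y - x|
    & `|p.[y] - p.[x] - p^`().[x] * (y - x)| <= C * (y - x) ^+ 2].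
Proof.
elim/poly_ind: p => [|p c [C C0 IH]].
  by exists 0 => // x y _ _; rewrite deriv0 !horner0 !mul0r !subr0 normr0; split.
exists (2 * C + `|c|); first by rewrite addr_ge0// mulr_ge0.
move=> x y x01 y01; have [h1 h2 h3 h4] := IH x y x01 y01.
have xn : `|x| <= 1 by case/andP: x01 => *; rewrite ger0_norm.
have yn : `|y| <= 1 by case/andP: y01 => *; rewrite ger0_norm.
have mul1 (a b d : R) : `|a| <= 1 -> `|b| <= d -> `|a * b| <= d.
  move=> ? bd; rewrite normrM -[leRHS]mul1r ler_pM//.
rewrite derivMXaddC !(hornerMXaddC, hornerD, hornerMX); split.
- apply: (le_trans (ler_normD _ _)); rewrite lerD2r mulrC.
  by apply: (le_trans (mul1 _ _ _ xn h1)); rewrite mulr_natl mulr2n lerDl.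
- apply: (le_trans (ler_normD _ _)).
  have := mul1 _ _ _ xn h2; rewrite [x * _]mulrC => h.
  have c0 := normr_ge0 c.
  lra.
- have -> : p.[y] * y + c - (p.[x] * x + c) =
    y * (p.[y] - p.[x]) + p.[x] * (y - x) by ring.
  apply: (le_trans (ler_normD _ _)).
  have a1 := mul1 _ _ _ yn h3.
  have a2 : `|p.[x] * (y - x)| <= C * `|y - x| by rewrite normrM ler_wpM2r.
  have : 0 <= `|c| * `|y - x| by rewrite mulr_ge0.
  lra.
- have -> : p.[y] * y + c - (p.[x] * x + c) - (p.[x] + p^`().[x] * x) * (y - x)
    = y * (p.[y] - p.[x] - p^`().[x] * (y - x)) + p^`().[x] * (y - x) ^+ 2.
    by ring.
  apply: (le_trans (ler_normD _ _)).
  have a1 := mul1 _ _ _ yn h4.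
  have a2 : `|p^`().[x] * (y - x) ^+ 2| <= C * (y - x) ^+ 2.
    by rewrite normrM (ger0_norm (sqr_ge0 _)) ler_wpM2r// sqr_ge0.
  have : 0 <= `|c| * (y - x) ^+ 2 by rewrite mulr_ge0// sqr_ge0.
  move=> h; apply: (le_trans (lerD a1 a2)).
  by rewrite [leRHS]mulrDl -mulrA mulr_natl mulr2n lerDl.
Qed.

Definition clamp (u : R) : R := Num.max 0 (Num.min 1 u).

Lemma clamp_itv u : 0 <= clamp u <= 1.
Proof. by rewrite /clamp le_max lexx/= ge_max ler01 ge_min lexx. Qed.

Variant clamp_spec u : R -> Type :=
| ClampLt of u < 0 : clamp_spec u 0
| ClampMid of 0 <= u <= 1 : clamp_spec u u
| ClampGt of 1 < u : clamp_spec u 1.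

Lemma clampP u : clamp_spec u (clamp u).
Proof.
rewrite /clamp; case: (leP 1 u) => [u1|u1].
  rewrite (elimT max_idPr) ?ler01//.
  case: (ltrgtP 1 u) u1 => // [u1 _|<- _]; first exact: ClampGt.
  by apply: ClampMid; rewrite ler01 lexx.
case: (ltP 0 u) => u0; first by apply: ClampMid; rewrite !ltW.
case: (ltrgtP u 0) u0 => // [u0 _|-> _]; first exact: ClampLt.
by apply: ClampMid; rewrite lexx ler01.
Qed.

Lemma clamp_id u : 0 <= u <= 1 -> clamp u = u.
Proof. by case: clampP => // h; lra. Qed.

Lemma half_itv : 0 <= (1 / 2 : R) <= 1.
Proof. by apply/andP; split; lra. Qed.

Lemma clamp_lip u v : `|clamp u - clamp v| <= `|u - v|.
Proof.
case: clampP => hu; case: clampP => hv;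
  rewrite ler_norml; case: (leP 0 (u - v)) => h;
  rewrite ?(ger0_norm h) ?(ltr0_norm h); lra.
Qed.

Lemma clamp_mono u v : v <= u -> clamp v <= clamp u.
Proof. by case: clampP => hu; case: clampP => hv; lra. Qed.

Lemma measurable_clamp : measurable_fun setT clamp.
Proof.
by apply: measurable_maxr => //; apply: measurable_minr.
Qed.

(** For u >= 0, [clamp (u - j)] is the length of [0, u] inside [j, j + 1]; these lengths add up to
    the truncation of u to [0, N]. *)
Lemma sum_clamp N u : \sum_(j < N) clamp (u - j%:R) = Num.max 0 (Num.min N%:R u).
Proof.
elim: N => [|N IH]; first by rewrite big_ord0 max_l// ge_min lexx.
rewrite big_ord_recr/= IH -natr1.
have N0 : 0 <= N%:R :> R by [].
case: clampP => h; rewrite /Num.max /Num.min;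
  case: (ltP N%:R u) => ?; case: (ltP (N%:R + 1) u) => ?; do ?[case: ltP => ?]; lra.
Qed.

(** Monotonicity removes the absolute values, and truncation to [0, N] is 1-Lipschitz. This is what
    makes the constants for sums of bumps independent of N. *)
Lemma sum_clampB N u v : v <= u ->
  \sum_(j < N) `|clamp (u - j%:R) - clamp (v - j%:R)| <= u - v.
Proof.
move=> vu; under eq_bigr => j _.
  rewrite ger0_norm; last by rewrite subr_ge0 clamp_mono// lerB.
  over.
rewrite sumrB !sum_clamp; have N0 : 0 <= N%:R :> R by [].
rewrite /Num.max /Num.min;
  case: (ltP N%:R u) => ?; case: (ltP N%:R v) => ?; do ?[case: ltP => ?]; lra.
Qed.

End polynomials_on_unit_interval.

Section one_sided_derivatives.
Context {R : realType}.
Implicit Types (g : R -> R) (x y : R).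

(** Makes limits along [nbhs01 x] unique. The nearby point lies to the right of x when x <= 1/2 and
    to the left otherwise, so that it stays in [0, 1]. *)
Lemma nbhs01_proper x : x \in `[0, 1] -> ProperFilter (nbhs01 x).
Proof.
rewrite in_itv/= => /andP[x0 x1]; apply: Build_ProperFilter_ex => U.
rewrite /nbhs01 /within/= => -[e /= e0 eU].
have [xh|xh] := leP x (1 / 2).
  have d0 : 0 < Num.min (e / 2) (1 / 2) by rewrite lt_min; apply/andP; split; lra.
  have [de d2] : Num.min (e / 2) (1 / 2) <= e / 2 /\ Num.min (e / 2) (1 / 2) <= 1 / 2.
    by rewrite !ge_min !lexx orbT.
  move: d0 de d2; set d := Num.min _ _ => d0 de d2.
  exists (x + d); apply: eU => /=.
  - by rewrite opprD addNKr normrN gtr0_norm//; lra.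
  - by apply/eqP; lra.
  - by rewrite in_itv/=; apply/andP; split; lra.
have d0 : 0 < Num.min (e / 2) (1 / 2) by rewrite lt_min; apply/andP; split; lra.
have [de d2] : Num.min (e / 2) (1 / 2) <= e / 2 /\ Num.min (e / 2) (1 / 2) <= 1 / 2.
  by rewrite !ge_min !lexx orbT.
move: d0 de d2; set d := Num.min _ _ => d0 de d2.
exists (x - d); apply: eU => /=.
- by rewrite opprB addrC subrK gtr0_norm//; lra.
- by apply/eqP; lra.
- by rewrite in_itv/=; apply/andP; split; lra.
Qed.

Lemma cvg_dquot g x (D C : R) : x \in `[0, 1] ->
  (forall y, y \in `[0, 1] -> `|g y - g x - D * (y - x)| <= C * (y - x) ^+ 2) ->
  dquot g x @ nbhs01 x --> D.
Proof.
move=> x01 h; have ? := nbhs01_proper x01.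
have C0 : 0 < `|C| + 1 by rewrite ltr_wpDl.
apply/cvgrPdist_le => e e0.
rewrite /nbhs01 near_withinE; exists (e / (`|C| + 1)) => /=; first exact: divr_gt0.
move=> y /= yx ynx y01.
have yx0 : y - x != 0 by rewrite subr_eq0.
have -> : D - dquot g x y = - ((g y - g x - D * (y - x)) / (y - x)).
  by rewrite /dquot; field.
rewrite normrN normrM normfV ler_pdivrMr ?normr_gt0//.
apply: (le_trans (h y y01)); rewrite -real_normK ?num_real// expr2 mulrA.
rewrite ler_wpM2r//; rewrite distrC in yx; apply: (@le_trans _ _ ((`|C| + 1) * `|y - x|)).
  by rewrite ler_wpM2r// (le_trans (ler_norm _))// lerDl.
by rewrite mulrC -ler_pdivlMr// ltW.
Qed.

Lemma deriv01_quad g (g' : R -> R) C :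
  (forall x y, x \in `[0, 1] -> y \in `[0, 1] ->
    `|g y - g x - g' x * (y - x)| <= C * (y - x) ^+ 2) ->
  derivable01 g /\ forall x, x \in `[0, 1] -> deriv01 g x = g' x.
Proof.
move=> h; split=> x x01; have cv := cvg_dquot x01 (fun y => h x y x01).
  by apply/cvg_ex; exists (g' x).
by have ? := nbhs01_proper x01; exact: cvg_lim cv.
Qed.

End one_sided_derivatives.

(** * Sums of clamped polynomial bumps *)

Section bump_sums.
Context {R : realType}.
Implicit Types (p : {poly R}) (c : nat -> R) (u v x y : R).

(** Bump j occupies [j, j + 1]: elsewhere the clamp freezes the argument at 0 or 1, where the
    polynomials in use vanish. *)
Definition bump_sum p (N : nat) c u : R := \sum_(j < N) c j * p.[clamp (u - j%:R)].

Lemma measurable_bump_sum p N c (m s : R) :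
  measurable_fun setT (fun x => bump_sum p N c (m * x - s)).
Proof.
apply: measurable_sum => j; apply: measurable_funM => //.
apply: (@measurableT_comp _ _ _ _ _ _ (horner p)).
  by apply: continuous_measurable_fun => u; exact: continuous_horner.
apply: measurableT_comp; first exact: measurable_clamp.
by apply: measurable_funB => //; apply: measurable_funB => //; exact: measurable_funM.
Qed.

Lemma bump_sum_lip p N c (A L : R) : 0 <= L ->
  (forall x y, 0 <= x <= 1 -> 0 <= y <= 1 -> `|p.[y] - p.[x]| <= L * `|y - x|) ->
  (forall j, `|c j| <= A) ->
  forall u v, `|bump_sum p N c u - bump_sum p N c v| <= A * L * `|u - v|.
Proof.
move=> L0 pL cA; have A0 : 0 <= A by exact: le_trans (cA 0).
suff h u v : v <= u -> `|bump_sum p N c u - bump_sum p N c v| <= A * L * (u - v).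
  move=> u v; have [vu|/ltW uv] := leP v u.
    by rewrite (ger0_norm (_ : 0 <= u - v)) ?subr_ge0// h.
  by rewrite distrC (distrC u) (ger0_norm (_ : 0 <= v - u)) ?subr_ge0// h.
move=> vu; rewrite /bump_sum -sumrB; apply: (le_trans (ler_norm_sum _ _ _)).
apply: (@le_trans _ _
    (\sum_(j < N) A * L * `|clamp (u - j%:R) - clamp (v - j%:R)|)).
  apply: ler_sum => j _; rewrite -mulrBr normrM -mulrA ler_pM//.
  by apply: pL; exact: clamp_itv.
by rewrite -mulr_sumr ler_wpM2l ?mulr_ge0// sum_clampB.
Qed.

Lemma clampB_int (k : int) (j : nat) :
  clamp (k%:~R - j%:R : R) = 0 \/ clamp (k%:~R - j%:R : R) = 1.
Proof.
have -> : k%:~R - j%:R = (k - j%:Z)%:~R :> R by rewrite rmorphB.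
case: clampP => //; [by left| |by right].
rewrite ler0z -[1]/(1%:~R) ler_int => h.
have [->|->] : k - j%:Z = 0 \/ k - j%:Z = 1 by lia.
  by left.
by right.
Qed.

Lemma bump_sum_int p N c (k : int) : p.[0] = 0 -> p.[1] = 0 ->
  bump_sum p N c k%:~R = 0.
Proof.
move=> p0 p1; rewrite /bump_sum big1// => j _.
by case: (clampB_int k j) => ->; rewrite ?p0 ?p1 mulr0.
Qed.

(** A bump sum vanishes at the integers and u is within 1 of its floor, so the Lipschitz bound turns
    into a uniform one. *)
Lemma bump_sum_bound p N c (A L : R) : 0 <= L -> p.[0] = 0 -> p.[1] = 0 ->
  (forall x y, 0 <= x <= 1 -> 0 <= y <= 1 -> `|p.[y] - p.[x]| <= L * `|y - x|) ->
  (forall j, `|c j| <= A) ->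
  forall u, `|bump_sum p N c u| <= A * L.
Proof.
move=> L0 p0 p1 pL cA u.
have A0 : 0 <= A by exact: le_trans (cA 0).
have := bump_sum_lip N L0 pL cA u (Num.floor u)%:~R.
rewrite bump_sum_int// subr0 => /le_trans; apply.
rewrite -[leRHS]mulr1 ler_wpM2l ?mulr_ge0//.
have := floor_itv u.
rewrite rmorphD/= => /andP[h1 h2].
by rewrite ger0_norm ?subr_ge0//; lra.
Qed.

(** The Lipschitz bound serves distances up to 1, the uniform bound larger ones; the latter costs
    the factor 2. *)
Lemma bump_sum_hoelder p N c (A L b : R) : 0 <= L -> p.[0] = 0 -> p.[1] = 0 ->
  (forall x y, 0 <= x <= 1 -> 0 <= y <= 1 -> `|p.[y] - p.[x]| <= L * `|y - x|) ->
  (forall j, `|c j| <= A) -> 0 < b <= 1 ->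
  forall u v, `|bump_sum p N c u - bump_sum p N c v| <= 2 * A * L * `|u - v| `^ b.
Proof.
move=> L0 p0 p1 pL cA /andP[b0 b1] u v.
have A0 : 0 <= A by exact: le_trans (cA 0).
have AL : 0 <= A * L by rewrite mulr_ge0.
have [uv1|uv1] := leP `|u - v| 1.
  apply: (le_trans (bump_sum_lip N L0 pL cA u v)).
  apply: (@le_trans _ _ (A * L * `|u - v| `^ b)); last first.
    by rewrite ler_wpM2r ?powR_ge0//; lra.
  rewrite ler_wpM2l//.
  have [->|uv0] := eqVneq `|u - v| 0; first by rewrite powR_ge0.
  have := @ger_powR R `|u - v|; rewrite lt_neqAle eq_sym uv0 normr_ge0 uv1 => h.
  by have := h isT _ _ b1; rewrite powRr1.
have h w := bump_sum_bound N L0 p0 p1 pL cA w.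
apply: (le_trans (ler_normB _ _)); apply: (le_trans (lerD (h u) (h v))).
have : 1 <= `|u - v| `^ b.
  by rewrite -[leLHS](powRr0 `|u - v|) ler_powR ?ltW.
move=> h1; have := ler_wpM2l (_ : 0 <= 2 * A * L) h1.
rewrite mulr1 => h2; apply: le_trans (h2 _); lra.
Qed.

End bump_sums.

Section smoothness_of_bump_sums.
Context {R : realType}.
Implicit Types (p : {poly R}) (c : nat -> R) (u v x y : R).

(** Besides the Taylor error of p there is a term with factor p'(clamp u) that is nonzero only when
    p'(clamp u) is and v is outside [0, 1]. Then u is inside, and p'(u) is at most a constant times
    the distance from u to the endpoint crossed, because p' vanishes there. *)
Lemma clamp_quad p : p^`().[0] = 0 -> p^`().[1] = 0 ->
  exists2 C : R, 0 <= C & forall u v,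
    `|p.[clamp v] - p.[clamp u] - p^`().[clamp u] * (v - u)| <= C * (v - u) ^+ 2.
Proof.
move=> p0 p1; have [C C0 hC] := poly_unit_bounds p.
have [D D0 hD] := poly_unit_bounds p^`().
exists (C + D); first exact: addr_ge0.
move=> u v; have [_ _ _ h1] := hC _ _ (clamp_itv u) (clamp_itv v).
have -> : p.[clamp v] - p.[clamp u] - p^`().[clamp u] * (v - u) =
    (p.[clamp v] - p.[clamp u] - p^`().[clamp u] * (clamp v - clamp u)) +
    p^`().[clamp u] * ((clamp v - v) - (clamp u - u)) by ring.
apply: (le_trans (ler_normD _ _)); rewrite mulrDl; apply: lerD.
  apply: (le_trans h1); rewrite ler_wpM2l// -[leLHS]real_normK ?num_real//.
  by rewrite -[leRHS]real_normK ?num_real// lerXn2r ?nnegrE// clamp_lip.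
have Dsq : 0 <= D * (v - u) ^+ 2 by rewrite mulr_ge0// sqr_ge0.
have i0 : (0 : R) <= (0 : R) <= (1 : R) by rewrite lexx ler01.
have i1 : (0 : R) <= (1 : R) <= (1 : R) by rewrite lexx ler01.
case: clampP => hu; rewrite ?p0 ?p1 ?mul0r ?normr0//.
rewrite subrr subr0 normrM.
case: clampP => hv; rewrite ?subrr ?normr0 ?mulr0//.
- have [_ _ + _] := hD 0 u i0 hu; rewrite p0 !subr0 => h.
  rewrite sub0r normrN (ltr0_norm hv).
  apply: (le_trans (ler_wpM2r (_ : 0 <= - v) h)); first by lra.
  rewrite -mulrA ler_wpM2l//; case/andP: hu => u0 _; rewrite ger0_norm// expr2.
  by nra.
- have [_ _ + _] := hD 1 u i1 hu; rewrite p1 !subr0 => h.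
  rewrite (ltr0_norm (_ : 1 - v < 0)); last by lra.
  apply: (le_trans (ler_wpM2r (_ : 0 <= - (1 - v)) h)); first by lra.
  rewrite -mulrA ler_wpM2l//; case/andP: hu => _ u1.
  rewrite distrC ger0_norm ?subr_ge0// expr2.
  by nra.
Qed.

Lemma bump_sum_quad p N c (m s : R) : p^`().[0] = 0 -> p^`().[1] = 0 ->
  exists C : R, forall x y,
    `|bump_sum p N c (m * y - s) - bump_sum p N c (m * x - s)
      - m * bump_sum p^`() N c (m * x - s) * (y - x)| <= C * (y - x) ^+ 2.
Proof.
move=> p0 p1; have [C C0 hC] := clamp_quad p0 p1.
exists (\sum_(j < N) `|c j| * (C * m ^+ 2)) => x y.
rewrite /bump_sum mulr_sumr mulr_suml -!sumrB mulr_suml.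
apply: (le_trans (ler_norm_sum _ _ _)); apply: ler_sum => j _.
have := hC (m * x - s - j%:R) (m * y - s - j%:R).
have -> : m * y - s - j%:R - (m * x - s - j%:R) = m * (y - x) by ring.
rewrite exprMn [in leRHS]mulrA => h.
rewrite -[leRHS]mulrA.
apply: le_trans (ler_wpM2l (normr_ge0 (c j)) h).
by rewrite -normrM le_eqVlt; apply/orP; left; apply/eqP; congr `|_|; ring.
Qed.

(** Differentiating gives a bump sum for the derived polynomial, with a factor m. The vanishing at 0
    and 1 lets the quadratic estimate be applied again at each order below r; the constant [c0]
    survives at order 0 only. *)
Lemma nderiv01_bump_sum p (r : nat) N c (m s c0 : R) :
  (forall k, (k <= r)%N -> p^`(k).[0] = 0 /\ p^`(k).[1] = 0) ->
  let g := fun x => c0 + bump_sum p N c (m * x - s) in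
  (forall k, (k <= r)%N -> forall x, x \in `[0, 1] ->
    nderiv01 k g x = c0 *+ (k == 0%N) + m ^+ k * bump_sum p^`(k) N c (m * x - s))
  /\ forall k, (k < r)%N -> derivable01 (nderiv01 k g).
Proof.
move=> hp g.
have step k : (k < r)%N ->
    (forall x, x \in `[0, 1] ->
      nderiv01 k g x = c0 *+ (k == 0%N) + m ^+ k * bump_sum p^`(k) N c (m * x - s)) ->
    derivable01 (nderiv01 k g) /\ forall x, x \in `[0, 1] ->
      nderiv01 k.+1 g x = m ^+ k.+1 * bump_sum p^`(k.+1) N c (m * x - s).
  move=> kr hk; have [p0 p1] := hp _ kr.
  rewrite derivnS in p0 p1; have [C hC] := bump_sum_quad N c m s p0 p1.
  apply: (@deriv01_quad _ _ _ (`|m ^+ k| * C)) => x y x01 y01.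
  rewrite !hk// derivnS.
  have := ler_wpM2l (normr_ge0 (m ^+ k)) (hC x y); rewrite -normrM mulrA.
  by apply: le_trans; rewrite le_eqVlt; apply/orP; left; apply/eqP; congr `|_|;
    rewrite exprS; ring.
have main k : (k <= r)%N -> forall x, x \in `[0, 1] ->
    nderiv01 k g x = c0 *+ (k == 0%N) + m ^+ k * bump_sum p^`(k) N c (m * x - s).
  elim: k => [_ x _|k IH kr x x01]; first by rewrite expr0 mul1r derivn0.
  by rewrite (step k kr (IH (ltnW kr))).2// add0r.
by split=> // k kr; exact: (step k kr (main k (ltnW kr))).1.
Qed.

(** Each differentiation removes at most one factor q, so the zeros of q stay zeros of the first
    derivatives of a power of q. *)
Lemma derivn_expr_dvd (q : {poly R}) n k : (k <= n)%N ->
  exists t, (q ^+ n)^`(k) = q ^+ (n - k) * t.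
Proof.
elim: k => [_|k IH kn]; first by exists 1; rewrite derivn0 subn0 mulr1.
have [t ht] := IH (ltnW kn); rewrite derivnS ht derivM deriv_exp.
rewrite -[(n - k)%N]prednK ?subn_gt0// -subnS.
exists (q^`() * t *+ (n - k.+1).+1 + q * t^`()).
by rewrite exprS/= -mulr_natr -[in RHS]mulr_natr; ring.
Qed.

(** A derivative of order k costs m^k, which the heights A m^-b pay for: m^(k - b) <= 1 at the lower
    orders, and at the top order r the exponent b - r makes the powers of m cancel exactly. *)
Lemma bump_Lipschitz_class (b : R) : 0 < b -> exists (p : {poly R}) (L : R),
  [/\ 0 < L, [/\ p.[0] = 0, p.[1] = 0 & p.[1 / 2] = 1],
    forall x y, 0 <= x <= 1 -> 0 <= y <= 1 -> `|p.[y] - p.[x]| <= L * `|y - x|,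
    forall N c (A : R), (forall j, `|c j| <= A) ->
      forall u, `|bump_sum p N c u| <= A * L
  & forall N c (M m s c0 A : R), 1 <= m -> 0 <= A ->
      (forall j, `|c j| <= A * m `^ (- b)) -> `|c0| + A * L <= M ->
      Lipschitz_class b M (fun x => c0 + bump_sum p N c (m * x - s))].
Proof.
move=> b0; have := sfloor_itv b0; set r := sfloor b => /andP[rb br].
(* The factor 4 gives q(1/2) = 1; the power r + 1 makes the derivatives of orders 0 to r vanish at 0
   and 1. *)
pose q : {poly R} := 4%:P * 'X * (1%:P - 'X).
pose p := q ^+ r.+1.
have qE x : q.[x] = 4 * x * (1 - x) by rewrite !(hornerM, hornerD, hornerN, hornerC, hornerX).
have q0 : q.[0] = 0 by rewrite qE mulr0 mul0r.
have q1 : q.[1] = 0 by rewrite qE subrr mulr0.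
have hp k : (k <= r)%N -> p^`(k).[0] = 0 /\ p^`(k).[1] = 0.
  move=> kr; have [t ->] := derivn_expr_dvd q (leqW kr).
  by rewrite subSn// exprS -mulrA !(hornerM q) q0 q1 !mul0r.
have [p0 p1] := hp 0%N isT; rewrite derivn0 in p0 p1.
pose Cf k := sval (cid2 (poly_unit_bounds p^`(k))).
have Cf0 k : 0 <= Cf k by rewrite /Cf; case: cid2.
have CfL k x y : 0 <= x <= 1 -> 0 <= y <= 1 ->
    `|p^`(k).[y] - p^`(k).[x]| <= Cf k * `|y - x|.
  by rewrite /Cf; case: cid2 => C ? h /= hx hy; have [] := h x y hx hy.
(* The 2 pays for the factor 2 in the Hölder bound; the 1 makes L positive. *)
pose L := 2 * (1 + \sum_(k < r.+1) Cf k).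
have SC : 0 <= \sum_(k < r.+1) Cf k by exact: sumr_ge0.
have CL k : (k <= r)%N -> 2 * Cf k <= L.
  move=> kr; rewrite /L (bigD1 (Ordinal (kr : (k < r.+1)%N)))//=.
  set T := (X in Cf k + X); have : 0 <= T by exact: sumr_ge0.
  by have := Cf0 k; lra.
have L0 : 0 < L by rewrite /L; lra.
exists p, L; split=> //.
- split=> //; rewrite /p horner_exp qE.
  by rewrite (_ : _ * _ = 1) ?expr1n//; field.
- move=> x y x01 y01; have := CfL 0%N x y x01 y01; rewrite derivn0.
  move/le_trans; apply; rewrite ler_wpM2r//.
  by have := CL 0%N isT; have := Cf0 0%N; lra.
- move=> N c A cA u.
  have A0 : 0 <= A by exact: le_trans (cA 0%N).
  have := bump_sum_bound N (Cf0 0%N) p0 p1 (CfL 0%N) cA u.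
  move/le_trans; apply; rewrite ler_wpM2l//.
  by have := CL 0%N isT; have := Cf0 0%N; lra.
move=> N c M m s c0 A m1 A0 cA hM.
have m0 : 0 < m by exact: lt_le_trans m1.
have [hd hder] := nderiv01_bump_sum N c m s c0 hp.
split.
- by move=> k kr; exact: hder.
- move=> k x kr x01; rewrite hd ?(ltnW kr)//.
  apply: (le_trans (ler_normD _ _)); apply: le_trans hM; apply: lerD.
    by case: k kr => [|k] _ //; rewrite normr0.
  have [pk0 pk1] := hp k (ltnW kr).
  have := bump_sum_bound N (Cf0 k) pk0 pk1 (CfL k) cA (m * x - s).
  rewrite normrM (ger0_norm (exprn_ge0 _ (ltW m0))) => h.
  apply: (le_trans (ler_wpM2l _ h)); first exact: exprn_ge0 (ltW m0).
  have -> : m ^+ k * (A * m `^ (- b) * Cf k) = A * Cf k * m `^ (k%:R - b).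
    by rewrite powRD ?(gt_eqF m0) ?implybT// powR_mulrn ?ltW//; ring.
  rewrite -[leRHS]mulr1 ler_pM ?mulr_ge0 ?powR_ge0//.
    by rewrite ler_wpM2l//; have := CL k (ltnW kr); have := Cf0 k; lra.
  rewrite -[leRHS](powRr0 m) ler_powR//.
  have : k%:R <= r%:R :> R by rewrite ler_nat ltnW.
  by lra.
- move=> x y x01 y01; rewrite !hd// opprD addrACA subrr add0r -mulrBr normrM.
  rewrite (ger0_norm (exprn_ge0 _ (ltW m0))).
  have [pk0 pk1] := hp r (leqnn r).
  have br1 : 0 < b - r%:R <= 1.
    by clear -rb br; rewrite -natr1 in br; apply/andP; split; lra.
  have := bump_sum_hoelder N (Cf0 r) pk0 pk1 (CfL r) cA br1 (m * x - s) (m * y - s).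
  have -> : m * x - s - (m * y - s) = m * (x - y) by ring.
  rewrite normrM (gtr0_norm m0) (powRM _ (ltW m0) (normr_ge0 _)) => h.
  apply: (le_trans (ler_wpM2l _ h)); first exact: exprn_ge0 (ltW m0).
  have -> : m ^+ r * (2 * (A * m `^ (- b)) * Cf r *
      (m `^ (b - r%:R) * `|x - y| `^ (b - r%:R))) =
      (A * (2 * Cf r)) * (m `^ r%:R * m `^ (- b) * m `^ (b - r%:R)) *
      `|x - y| `^ (b - r%:R).
    by rewrite powR_mulrn ?ltW//; ring.
  rewrite -!powRD ?(gt_eqF m0) ?implybT//.
  rewrite (_ : r%:R - b + (b - r%:R) = 0) ?powRr0; last by ring.
  rewrite mulr1 ler_wpM2r ?powR_ge0//.
  apply: (@le_trans _ _ (A * L)); first by rewrite ler_wpM2l// CL.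
  by have := normr_ge0 c0; lra.
Qed.

End smoothness_of_bump_sums.

(** * Comparison of laws and the two-point method *)

Section square_domination.
Context {R : realType}.
Local Notation mu := (@lebesgue_measure R).
Local Notation prob := (probability (measurableTypeR R) R).

Definition has_density (nu : prob) (p : R -> R) : Prop :=
  [/\ measurable_fun setT p, forall x, 0 <= p x
    & forall A, measurable A -> nu A = (\int[mu]_(x in A) (p x)%:E)%E].

(** The density agrees almost everywhere with the Radon-Nikodym derivative, since both have the same
    integral over every measurable set. The bound on g makes it integrable. *)
Lemma integral_density (nu : prob) p (g : R -> R) : has_density nu p ->
  measurable_fun setT g -> (forall x, 0 <= g x <= 1) ->
  (\int[nu]_x (g x)%:E = \int[mu]_x (g x * p x)%:E)%E.
Proof.
move=> [mp p0 nup] mg g01.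
have dom : nu `<< mu.
  apply/null_content_dominatesP => A mA muA0; rewrite nup//.
  by apply: null_set_integral => //; apply/measurable_EFinP; exact: measurable_funTS.
have intp : mu.-integrable setT (EFin \o p).
  apply/integrableP; split; first exact/measurable_EFinP.
  under eq_integral do rewrite /= ger0_norm//.
  by rewrite -(nup setT)// probability_setT ltry.
have intg : nu.-integrable setT (EFin \o g).
  apply/integrableP; split; first exact/measurable_EFinP.
  apply: (@le_lt_trans _ _ (\int[nu]_x 1)%E).
    apply: ge0_le_integral => //.
      by apply/measurable_EFinP; exact: measurableT_comp.
    by move=> x _; have /andP[? ?] := g01 x; rewrite /= lee_fin ger0_norm.
  rewrite integral_cst// mul1e; exact: le_lt_trans (probability_le1 nu measurableT) (ltry 1).
rewrite -(Radon_Nikodym_change_of_variables dom)//=.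
under [RHS]eq_integral do rewrite EFinM.
apply: ae_eq_integral => //.
- apply: emeasurable_funM; first exact/measurable_EFinP.
  by apply: (measurable_int mu); exact: Radon_Nikodym_integrable.
- by apply: emeasurable_funM; exact/measurable_EFinP.
- apply: ae_eqe_mul2l => /=.
  rewrite Radon_NikodymE//=.
  case: cid => /= h [h1 h2 h3].
  apply: integral_ae_eq => //=.
  + exact/measurable_EFinP.
  + by move=> E _ mE; rewrite -h3//= nup.
Qed.

(** Stated for functions and not only for events: in the induction over coordinates, g is the mass
    of a section. *)
Definition square_dominated (K : R) (nu0 nu1 : prob) : Prop :=
  forall g : R -> R, measurable_fun setT g -> (forall x, 0 <= g x <= 1) ->
  ((\int[nu1]_x (g x)%:E) ^+ 2 <= K%:E * \int[nu0]_x ((g x) ^+ 2)%:E)%E.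

(* Cauchy-Schwarz for [g * sqrt p0] and [p1 / sqrt p0], through the quadratic
   [t |-> t * int g^2 p0 + K / t - 2 * int g p1 >= 0]. *)
Lemma density_square_dominated (nu0 nu1 : prob) p0 p1 (K : R) :
  has_density nu0 p0 -> has_density nu1 p1 -> (forall x, 0 < p0 x) -> 0 < K ->
  measurable_fun setT (fun x => p1 x ^+ 2 / p0 x) ->
  (\int[mu]_x (p1 x ^+ 2 / p0 x)%:E <= K%:E)%E ->
  square_dominated K nu0 nu1.
Proof.
move=> d0 d1 p0gt0 K0 mq hK g mg g01.
have [mp0 p0ge0 _] := d0; have [mp1 p1ge0 _] := d1.
have mg2 : measurable_fun setT (fun x => g x ^+ 2) by exact: measurable_funX.
have g2 x : 0 <= g x ^+ 2 <= 1.
  have /andP[? ?] := g01 x; rewrite sqr_ge0/= expr_le1//.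
have le1 (nu : prob) (h : R -> R) : measurable_fun setT h ->
    (forall x, 0 <= h x <= 1) ->
    exists2 b : R, (\int[nu]_x (h x)%:E)%E = b%:E & 0 <= b.
  move=> mh h01.
  have ge0 : (0 <= \int[nu]_x (h x)%:E)%E.
    by apply: integral_ge0 => x _; rewrite lee_fin; case/andP: (h01 x).
  have le1 : (\int[nu]_x (h x)%:E <= 1)%E.
    apply: (@le_trans _ _ (\int[nu]_x 1)%E).
      apply: ge0_le_integral => //.
      - by move=> x _; rewrite lee_fin; case/andP: (h01 x).
      - exact/measurable_EFinP.
      - by move=> x _; rewrite lee_fin; case/andP: (h01 x).
    rewrite integral_cst// mul1e; exact: (probability_le1 nu measurableT).
  exists (fine (\int[nu]_x (h x)%:E)%E); last by rewrite fine_ge0.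
  by rewrite fineK// ge0_fin_numE// (le_lt_trans le1)// ltry.
have [b hb b0] := le1 nu1 g mg g01.
have [a ha a0] := le1 nu0 (fun x => g x ^+ 2) mg2 g2.
rewrite hb ha -EFin_expe -EFinM lee_fin.
have [bz|bn] := eqVneq b 0; first by rewrite bz expr0n/= mulr_ge0// ltW.
have bgt0 : 0 < b by rewrite lt_neqAle eq_sym bn.
have main t : 0 < t -> 2 * b <= t * a + K / t.
  move=> t0; rewrite -lee_fin EFinD !EFinM -hb -ha.
  rewrite (integral_density d1)// (integral_density d0)//.
  have mgp1 : measurable_fun setT (fun x => g x * p1 x) by exact: measurable_funM.
  have mgp0 : measurable_fun setT (fun x => g x ^+ 2 * p0 x) by exact: measurable_funM.
  have me1 : measurable_fun setT (fun x => (g x * p1 x)%:E) by exact/measurable_EFinP.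
  have me0 : measurable_fun setT (fun x => (g x ^+ 2 * p0 x)%:E) by exact/measurable_EFinP.
  have meq : measurable_fun setT (fun x => (p1 x ^+ 2 / p0 x)%:E) by exact/measurable_EFinP.
  have n1 x : setT x -> (0 <= (g x * p1 x)%:E)%E.
    by move=> _; rewrite lee_fin mulr_ge0//; case/andP: (g01 x).
  have n0 x : setT x -> (0 <= (g x ^+ 2 * p0 x)%:E)%E.
    by move=> _; rewrite lee_fin mulr_ge0//; case/andP: (g2 x).
  have nq x : setT x -> (0 <= (p1 x ^+ 2 / p0 x)%:E)%E.
    by move=> _; rewrite lee_fin divr_ge0// sqr_ge0.
  have t0E : (0 <= t%:E)%E by rewrite lee_fin ltW.
  have tvE : (0 <= t^-1%:E)%E by rewrite lee_fin invr_ge0 ltW.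
  have two : (0 <= 2%:E :> \bar R)%E by rewrite lee_fin.
  apply: (@le_trans _ _ (t%:E * \int[mu]_x (g x ^+ 2 * p0 x)%:E +
      t^-1%:E * \int[mu]_x (p1 x ^+ 2 / p0 x)%:E)%E); last first.
    by rewrite leeD2l// muleC lee_wpmul2r.
  rewrite -(ge0_integralZl mu measurableT me1 n1 two).
  rewrite -(ge0_integralZl mu measurableT me0 n0 t0E).
  rewrite -(ge0_integralZl mu measurableT meq nq tvE).
  rewrite -ge0_integralD//; first last.
  - exact: measurable_funeM.
  - by move=> x xT; apply: mule_ge0 => //; (exact: n0 || exact: nq || exact: n1).
  - exact: measurable_funeM.
  - by move=> x xT; apply: mule_ge0 => //; (exact: n0 || exact: nq || exact: n1).
  apply: ge0_le_integral => //.
  - by move=> x xT; apply: mule_ge0 => //; (exact: n0 || exact: nq || exact: n1).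
  - exact: measurable_funeM.
  - by apply: emeasurable_funD; exact: measurable_funeM.
  move=> x _; rewrite -!EFinM -EFinD lee_fin -subr_ge0.
  have p0n : p0 x != 0 by rewrite gt_eqF.
  have tn : t != 0 by rewrite gt_eqF.
  rewrite (_ : _ - _ = (t * g x * p0 x - p1 x) ^+ 2 / (t * p0 x)).
    by rewrite divr_ge0 ?sqr_ge0// mulr_ge0// ltW.
  by field; rewrite tn p0n.
(* With t = K / b the term K / t equals b, and the inequality becomes b^2 <= K a. *)
have := main (K / b) (divr_gt0 K0 bgt0).
have -> : K / (K / b) = b by field; rewrite !gt_eqF.
by rewrite mulr_natl mulr2n lerD2r mulrAC ler_pdivlMr// expr2.
Qed.

End square_domination.

(** * Tensorization over independent coordinates *)

Section product_laws.
Context {R : realType}.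
Local Notation prob := (probability (measurableTypeR R) R).
Local Notation tprob n := (probability (n.-tuple (measurableTypeR R)) R).

Definition box n (B : 'I_n -> set R) : set (n.-tuple (measurableTypeR R)) :=
  [set t | forall i, B i (tnth t i)].

Lemma measurable_box n (B : 'I_n -> set (measurableTypeR R)) :
  (forall i, measurable (B i)) -> measurable (box B).
Proof.
move=> mB; rewrite (_ : box B = \bigcap_(i in [set: 'I_n]) (fun t => tnth t i) @^-1` B i).
  apply: fin_bigcap_measurable; first exact: finite_finset.
  by move=> i _; rewrite -[X in measurable X]setTI; exact: measurable_tnth.
by apply/seteqP; split => t h i; [move=> _|]; exact: h.
Qed.

Definition product_law n (nu : 'I_n -> prob) (m : set (n.-tuple (measurableTypeR R)) -> \bar R) : Prop :=
  forall B : 'I_n -> set (measurableTypeR R), (forall i, measurable (B i)) ->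
    m (box B) = (\prod_(i < n) nu i (B i))%E.

(** Boxes are stable under intersection and generate the sigma-algebra of tuples. It serves to
    identify product laws that were built in different ways. *)
Lemma product_law_unique n (m m' : {measure set (n.-tuple (measurableTypeR R)) -> \bar R}) :
  (m setT < +oo)%E ->
  (forall B : 'I_n -> set (measurableTypeR R), (forall i, measurable (B i)) ->
    m (box B) = m' (box B)) ->
  forall A, measurable A -> m A = m' A.
Proof.
move=> mfin mm'.
pose G := [set A | exists2 B : 'I_n -> set (measurableTypeR R),
  forall i, measurable (B i) & A = box B].
have boxT : box (fun=> setT) = setT :> set (n.-tuple (measurableTypeR R)).
  by apply/seteqP; split.
apply: (@measure_unique _ _ _ G (fun=> setT)) => //.
- apply/seteqP; split; last first.
    apply: smallest_sub; first exact: sigma_algebra_measurable.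
    by move=> _ [B mB ->]; exact: measurable_box.
  apply: smallest_sub; first exact: smallest_sigma_algebra.
  move=> A bA; apply: sub_sigma_algebra; move: A bA.
  rewrite -bigcup_seq => A [i _ [B mB <-]]; rewrite setTI.
  (* A cylinder over coordinate i is a box whose other sides are the whole line. *)
  exists (fun j => if j == i then B else setT).
    by move=> j; case: ifP.
  apply/seteqP; split => t /=.
    by move=> h j; case: eqVneq => // ->.
  by move=> /(_ i); rewrite eqxx.
- move=> _ _ [B mB ->] [B' mB' ->]; exists (fun i => B i `&` B' i).
    by move=> i; exact: measurableI.
  apply/seteqP; split => t /=; first by move=> [h h'] i; split; [exact: h|exact: h'].
  by move=> h; split => i; have [] := h i.
- by move=> _; exists (fun=> setT).
- by rewrite bigcup_const//; exists 0%N.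
- by move=> _ [B mB ->]; exact: mm'.
Qed.

(** Induction on n: slice A along the first coordinate and let g(x) be the mass of the slice under
    [m1]. The induction hypothesis bounds g^2 pointwise by the mass of the slice under [m0], and the
    one-coordinate bound applied to g does the rest. *)
Lemma product_square_dominated n (nu0 nu1 : 'I_n -> prob) (K : 'I_n -> R) :
  (forall i, 0 < K i) -> (forall i, square_dominated (K i) (nu0 i) (nu1 i)) ->
  exists m0 m1 : tprob n, [/\ product_law nu0 m0, product_law nu1 m1
    & forall A, measurable A -> ((m1 A) ^+ 2 <= (\prod_(i < n) K i)%:E * m0 A)%E].
Proof.
elim: n nu0 nu1 K => [|n IH] nu0 nu1 K K0 dom.
  (* Without coordinates the law is the point mass at the empty tuple; its values 0 and 1 equal
     their squares. *)
  pose m : tprob 0 := \d_([tuple] : 0.-tuple (measurableTypeR R)).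
  have mE A : m A = ((([tuple] : 0.-tuple (measurableTypeR R)) \in A)%:R)%:E.
    by rewrite -diracE.
  have mlaw nu : product_law nu m.
    by move=> B mB; rewrite big_ord0 mE mem_set//; case.
  exists m, m; split=> // A mA; rewrite big_ord0 mul1e mE.
  by case: (_ \in A); rewrite -EFin_expe lee_fin ?expr1n// expr0n.
have [m0 [m1 [law0 law1 hm]]] := IH (fun i => nu0 (lift ord0 i))
  (fun i => nu1 (lift ord0 i)) (fun i => K (lift ord0 i))
  (fun i => K0 _) (fun i => dom _).
pose cons_tuple (p : measurableTypeR R * n.-tuple (measurableTypeR R)) :
  n.+1.-tuple (measurableTypeR R) := [the n.+1.-tuple _ of p.1 :: p.2].
have mcons : measurable_fun setT cons_tuple by exact: measurable_cons.
pose consM : {mfun _ >-> _} :=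
  HB.pack cons_tuple (isMeasurableFun.Build _ _ _ _ _ mcons).
pose ext (nu : 'I_n.+1 -> prob) (m : tprob n) : tprob n.+1 :=
  distribution (nu ord0 \x m)%E consM.
have extE nu (m : tprob n) A :
    ext nu m A = (nu ord0 \x m)%E (cons_tuple @^-1` A) by [].
have ext_law nu (m : tprob n) : product_law (fun i => nu (lift ord0 i)) m ->
    product_law nu (ext nu m).
  move=> law B mB; rewrite extE.
  rewrite (_ : _ @^-1` _ = B ord0 `*` box (fun i => B (lift ord0 i))).
    transitivity (nu ord0 (B ord0) * m (box (fun i => B (lift ord0 i))))%E.
      by apply: product_measure1E => //; exact: measurable_box.
    by rewrite law// big_ord_recl.
  apply/seteqP; split => -[x t] /=.
    move=> h; split; first exact: (h ord0).
    by move=> i; have := h (lift ord0 i); rewrite tnthS.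
  move=> [h0 h] i; case: (unliftP ord0 i) => [j|] ->//.
  by rewrite tnthS; exact: h.
exists (ext nu0 m0), (ext nu1 m1); split; [exact: ext_law|exact: ext_law|].
move=> A mA; rewrite !extE.
set A' := _ @^-1` A.
have mA' : measurable A'.
  by rewrite -[A']setTI; move: (mcons) => h; exact: h.
rewrite /product_measure1.
pose g x := fine (m1 (xsection A' x)).
have mx x : measurable (xsection A' x) by exact: measurable_xsection.
have gE x : (g x)%:E = m1 (xsection A' x) by rewrite fineK// fin_num_measure.
have mg : measurable_fun setT g.
  apply/measurable_EFinP; rewrite (_ : _ \o _ = m1 \o xsection A').
    exact: measurable_fun_xsection.
  by apply/funext => x /=; rewrite gE.
have g01 x : 0 <= g x <= 1.
  by rewrite -!lee_fin gE measure_ge0 probability_le1.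
have C0 : 0 <= \prod_(i < n) K (lift ord0 i).
  by apply: prodr_ge0 => i _; exact: ltW.
rewrite (_ : (\int[nu1 ord0]_x (m1 \o xsection A') x)%E = (\int[nu1 ord0]_x (g x)%:E)%E);
  last by apply: eq_integral => x _; rewrite /= gE.
apply: (le_trans (dom ord0 g mg g01)).
rewrite big_ord_recl EFinM -muleA; apply: lee_wpmul2l; first by rewrite lee_fin ltW.
have mx0 : measurable_fun setT (m0 \o xsection A') by exact: measurable_fun_xsection.
have x00 x : setT x -> (0 <= (m0 \o xsection A') x)%E by move=> _; exact: measure_ge0.
have C0E : (0 <= (\prod_(i < n) K (lift ord0 i))%:E)%E by rewrite lee_fin.
rewrite -(ge0_integralZl (nu0 ord0) measurableT mx0 x00 C0E).
apply: ge0_le_integral => //.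
- by move=> x _; rewrite lee_fin sqr_ge0.
- by apply/measurable_EFinP; exact: measurable_funX.
- exact: measurable_funeM.
- by move=> x _; rewrite EFin_expe gE hm.
Qed.

End product_laws.

(** * The two-point bound and finite mixtures *)

Section le_cam.
Context d (Y : measurableType d) {R : realType}.
Implicit Types m : probability Y R.

Lemma integral_ge_cst m (f : Y -> R) A (D : R) : measurable A ->
  measurable_fun setT f -> (forall y, 0 <= f y) -> 0 <= D ->
  (forall y, A y -> D <= f y) -> (D%:E * m A <= \int[m]_y (f y)%:E)%E.
Proof.
move=> mA mf f0 D0 Df; rewrite -integral_cst//.
apply: (@le_trans _ _ (\int[m]_(y in A) (f y)%:E)%E).
  apply: ge0_le_integral => //.
  by apply/measurable_EFinP; exact: measurable_funTS.
apply: ge0_subset_integral => //; first exact/measurable_EFinP.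
by move=> y _; rewrite lee_fin.
Qed.

(** An estimate within |v0 - v1| / 2 of v0 is at least that far from v1. With A the event of being
    far from v0 and b = m1 A, the sum of risks is at least D (b^2 / K + 1 - b), and b^2 + K (1 - b)
    >= b^2 + 1 - b >= 1/2. *)
Lemma le_cam_two_points m0 m1 (K : R) (t : Y -> R) (v0 v1 : R) : 1 <= K ->
  (forall A, measurable A -> ((m1 A) ^+ 2 <= K%:E * m0 A)%E) ->
  measurable_fun setT t ->
  (((v0 - v1) ^+ 2 / (8 * K))%:E <=
    \int[m0]_y ((t y - v0) ^+ 2)%:E + \int[m1]_y ((t y - v1) ^+ 2)%:E)%E.
Proof.
move=> K1 hK mt; set D := (v0 - v1) ^+ 2 / 4.
have D0 : 0 <= D by rewrite divr_ge0 ?sqr_ge0.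
have ms v : measurable_fun setT (fun y => (t y - v) ^+ 2).
  by apply: measurable_funX; exact: measurable_funB.
pose A := [set y | D <= (t y - v0) ^+ 2].
have mA : measurable A.
  rewrite (_ : A = setT `&` (fun y => (t y - v0) ^+ 2) @^-1` `[D, +oo[%classic).
    exact: ms.
  by rewrite setTI; apply/seteqP; split => y /=; rewrite in_itv/= andbT.
have h0 := integral_ge_cst m0 mA (ms v0) (fun y => sqr_ge0 _) D0 (fun y h => h).
have h1 : (D%:E * m1 (~` A) <= \int[m1]_y ((t y - v1) ^+ 2)%:E)%E.
  apply: integral_ge_cst => //; [exact: measurableC|by move=> y; exact: sqr_ge0|].
  move=> y /negP; rewrite -ltNge /D => ty.
  (* With x = t - v0 and y = t - v1, 2 x^2 + 2 y^2 = (x - y)^2 + (x + y)^2 >= 4 D, so x^2 < D forces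
     y^2 > D. *)
  have := sqr_ge0 ((t y - v0) + (t y - v1)).
  rewrite !expr2 in ty *; lra.
apply: le_trans (leeD h0 h1).
rewrite probability_setC//.
have aE : m0 A = (fine (m0 A))%:E by rewrite fineK// fin_num_measure.
have bE : m1 A = (fine (m1 A))%:E by rewrite fineK// fin_num_measure.
have b1 : fine (m1 A) <= 1.
  by rewrite -lee_fin fineK ?fin_num_measure// probability_le1.
have := hK A mA; rewrite aE bE -EFin_expe -EFinM lee_fin.
rewrite -EFinB -!EFinM -EFinD lee_fin.
move: b1; set a := fine (m0 A); set b := fine (m1 A) => b1 ba.
have K0 : 0 < K by lra.
have -> : (v0 - v1) ^+ 2 / (8 * K) = D * (1 / (2 * K)).
  by rewrite /D; field; rewrite gt_eqF.
rewrite -mulrDr ler_wpM2l// ler_pdivrMr ?mulr_gt0//.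
have : 0 <= (1 - b) * (K - 1) by rewrite mulr_ge0; lra.
have := sqr_ge0 (2 * b - 1).
rewrite !expr2 in ba *; lra.
Qed.

Lemma ex_sum_measure (I : Type) (s : seq I) (w : I -> R) (Q : I -> probability Y R) :
  (forall i, 0 <= w i) ->
  exists m : {measure set Y -> \bar R},
    (forall A, m A = (\sum_(i <- s) (w i)%:E * Q i A)%E) /\
    forall f, measurable_fun setT f -> (forall y, 0 <= f y)%E ->
      (\int[m]_y f y = \sum_(i <- s) (w i)%:E * \int[Q i]_y f y)%E.
Proof.
move=> w0; elim: s => [|i s [m [mA mf]]].
  exists mzero; split=> [A|f mf f0]; first by rewrite big_nil.
  by rewrite integral_measure_zero big_nil.
exists (measure_add (mscale (NngNum (w0 i)) (Q i)) m); split=> [A|f mf' f0].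
  by rewrite big_cons -mA; exact: measure_addE.
by rewrite ge0_integral_measure_add// ge0_integral_mscale// big_cons mf.
Qed.

Lemma ex_mixture (I : finType) (w : I -> R) (Q : I -> probability Y R) :
  (forall i, 0 <= w i) -> \sum_i w i = 1 ->
  exists m : probability Y R,
    (forall A, m A = (\sum_i (w i)%:E * Q i A)%E) /\
    forall f, measurable_fun setT f -> (forall y, 0 <= f y)%E ->
      (\int[m]_y f y = \sum_i (w i)%:E * \int[Q i]_y f y)%E.
Proof.
move=> w0 w1; have [m [mA mf]] := ex_sum_measure (index_enum I) Q w0.
have mT : m setT = 1%E.
  rewrite mA; under eq_bigr do rewrite probability_setT mule1.
  by rewrite sumEFin w1.
(* Weights summing to 1 need an index. [Q i0] is the default value that [mnormalize] asks for; the
   mass being 1, normalizing keeps the measure and supplies the structure of a probability. *)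
have [i0 _] : exists i0 : I, true.
  case: (pickP [pred i : I | true]) => [i0 _|h]; first by exists i0.
  by move: w1; rewrite big1 => [/esym/eqP|i _]; [rewrite oner_eq0|have := h i].
have m'A A : mnormalize m (Q i0) A = m A.
  by rewrite /mnormalize/= mT onee_eq0/= invr1 mule1.
exists (mnormalize m (Q i0)); split=> [A|f mf' f0]; first by rewrite -mA; exact: m'A.
by rewrite (eq_measure_integral m) ?mf// => A _ _; exact: m'A.
Qed.

End le_cam.

(** * Gaussian laws and the law of the observations *)

Section gaussian_laws.
Context {R : realType}.
Local Notation mu := (@lebesgue_measure R).

(** The right-hand side is a measure in A that gives half-open intervals their length, hence it is
    Lebesgue measure. *)
Lemma lebesgue_measure_affine (m s : R) (A : set (measurableTypeR R)) : 0 < s ->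
  measurable A -> mu A = (s%:E * mu ((fun x => m + s * x)%R @^-1` A))%E.
Proof.
move=> s0 mA; pose phi (x : measurableTypeR R) : measurableTypeR R := m + s * x.
have mphi : measurable_fun setT phi.
  by apply: measurable_funD => //; exact: measurable_funM.
pose push := [the {measure set (measurableTypeR R) -> \bar R} of pushforward mu phi].
pose nu : {measure set (measurableTypeR R) -> \bar R} :=
  mscale (NngNum (ltW s0)) (push mphi).
rewrite (@lebesgue_measure_unique R nu)// => _ [[a b] _ <-] /=.
rewrite /nu /mscale/= /pushforward.
have -> : phi @^-1` `]a, b]%classic = `](a - m) / s, (b - m) / s]%classic.
  apply/seteqP; split => x /=; rewrite !in_itv/= /phi ltr_pdivrMr// ler_pdivlMr//
    => /andP[? ?]; apply/andP; split; lra.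
rewrite !lebesgue_measure_itv/= !lte_fin ltr_pM2r ?invr_gt0// ltrD2r.
case: ifPn => _; last by rewrite mule0.
by rewrite -!EFinD -EFinM; congr EFin; field; rewrite gt_eqF.
Qed.

Lemma normal_prob_affine (m s : R) (A : set (measurableTypeR R)) : 0 < s ->
  measurable A ->
  normal_prob 0 1 ((fun x => m + s * x) @^-1` A) = normal_prob m s A.
Proof.
move=> s0 mA; pose phi (x : measurableTypeR R) : measurableTypeR R := m + s * x.
have mphi : measurable_fun setT phi.
  by apply: measurable_funD => //; exact: measurable_funM.
pose push := [the {measure set (measurableTypeR R) -> \bar R} of pushforward mu phi].
pose nu : {measure set (measurableTypeR R) -> \bar R} :=
  mscale (NngNum (ltW s0)) (push mphi).
have mpdf := measurable_normal_pdf m s.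
rewrite /normal_prob.
rewrite [RHS](eq_measure_integral nu); last first.
  by move=> B mB _; have := lebesgue_measure_affine m s0 mB; (exact || move=> h; exact: esym h).
rewrite /nu ge0_integral_mscale//; last 2 first.
- by apply/measurable_EFinP; exact: measurable_funTS.
- by move=> x _; rewrite lee_fin normal_pdf_ge0.
rewrite ge0_integral_pushforward//; last 2 first.
- by apply/measurable_EFinP; exact: measurable_funTS.
- by move=> x _; rewrite lee_fin normal_pdf_ge0.
have mA' : measurable (phi @^-1` A) by rewrite -[X in measurable X]setTI; move: (mphi) => h; exact: h.
have mf : measurable_fun (phi @^-1` A) ((fun y => (normal_pdf m s y)%:E) \o phi).
  by apply: measurable_funTS; apply/measurable_EFinP; exact: measurableT_comp.
have f0 x : (phi @^-1` A) x -> (0 <= ((fun y => (normal_pdf m s y)%:E) \o phi) x)%E.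
  by move=> _; rewrite lee_fin normal_pdf_ge0.
have s0E : (0 <= s%:E)%E by rewrite lee_fin ltW.
rewrite -(ge0_integralZl mu mA' mf f0 s0E).
apply: eq_integral => x _; rewrite -EFinM; congr EFin.
rewrite !normal_pdfE ?gt_eqF//= /normal_peak /normal_fun /phi.
rewrite -!mulrnAr (sqrtrM _ (sqr_ge0 s)) (sqrtrM _ (sqr_ge0 1)) !sqrtr_sqr (gtr0_norm s0) normr1 mul1r.
have -> : - (m + s * x - m) ^+ 2 / (s * (s *+ 2)) = - (x - 0) ^+ 2 / 2.
  by rewrite -mulr_natr; field; rewrite gt_eqF.
have : Num.sqrt (pi *+ 2) != 0 :> R by rewrite gt_eqF// sqrtr_gt0 pmulrn_lgt0// pi_gt0.
move: (Num.sqrt _) (expR _) => q e q0.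
by field; rewrite q0 gt_eqF.
Qed.

End gaussian_laws.

Section observation_laws.
Context d (T : measurableType d) (R : realType) (P : probability T R).
Variables (n : nat) (z : 'I_n -> {RV P >-> R}).
Local Notation mu := (@lebesgue_measure R).

Lemma measurable_observations (f V : R -> R) :
  measurable_fun setT (observations z f V : T -> n.-tuple (measurableTypeR R)).
Proof.
apply/measurable_fun_tnthP => i.
rewrite (_ : _ \o _ = fun w => f (design R i) + Num.sqrt (V (design R i)) * z i w).
  by apply: measurable_funD => //; exact: measurable_funM.
by apply/funext => w /=; rewrite tnth_mktuple.
Qed.

Lemma observation_law (f V : R -> R) : iid_std_normal z ->
  (forall i : 'I_n, 0 < V (design R i)) ->
  exists Q : probability (n.-tuple (measurableTypeR R)) R,
    product_law (fun i => normal_prob (f (design R i)) (Num.sqrt (V (design R i)))) Q /\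
    forall u : n.-tuple (measurableTypeR R) -> \bar R,
      measurable_fun setT u -> (forall y, 0 <= u y)%E ->
      (\int[Q]_y u y = \int[P]_w u (observations z f V w))%E.
Proof.
move=> [indep law] V0.
pose Y := observations z f V : T -> n.-tuple (measurableTypeR R).
have mY := measurable_observations f V.
pose YM : {mfun T >-> n.-tuple (measurableTypeR R)} :=
  HB.pack Y (isMeasurableFun.Build _ _ _ _ _ mY).
exists (distribution P YM); split; last first.
  by move=> u mu0 u0; exact: (@ge0_integral_distribution _ _ _ _ _ P YM _ mu0 u0).
move=> B mB.
pose phi (i : 'I_n) (x : measurableTypeR R) : measurableTypeR R :=
  f (design R i) + Num.sqrt (V (design R i)) * x.
have mphi i : measurable_fun setT (phi i).
  by apply: measurable_funD => //; exact: measurable_funM.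
pose A i : set R := phi i @^-1` B i.
have mA i : measurable (A i) by rewrite -[A i]setTI; exact: mphi.
(* The box for the data is pulled back to a box for the noise; independence is then used for the
   full set of indices. *)
transitivity (P (\bigcap_(i in [set` [set: 'I_n]%SET]) z i @^-1` A i)).
  rewrite /distribution /pushforward; congr (P _).
  apply/seteqP; split => w /= h i; have := h i; rewrite /Y tnth_mktuple.
    by move=> hi _; exact: hi.
  by rewrite /= inE => /(_ isT).
rewrite indep//; rewrite (eq_bigl xpredT); last by move=> i; rewrite inE.
apply: eq_bigr => i _.
apply: etrans (law i (A i) (mA i)) _.
by apply: normal_prob_affine => //; rewrite sqrtr_gt0.
Qed.

Lemma measurable_estimator (Vhat : n.-tuple R -> R -> R) (x : R) :
  estimators Vhat -> x \in `[0, 1] ->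
  measurable_fun setT (fun y : n.-tuple (measurableTypeR R) => Vhat y x).
Proof.
move=> mV x01.
apply: (@measurable_comp _ _ _ _ _ _ [set p : n.-tuple R * R | p.2 \in `[0, 1]]
  (fun p => Vhat p.1 p.2) _ (fun y => (y, x))).
- rewrite (_ : [set p | _] = setT `*` `[0%R, 1%R]%classic); first exact: measurableX.
  by apply/seteqP; split => p /=; [move=> h; split|move=> []].
- by move=> _ [y _ <-].
- exact: mV.
- by apply: measurable_fun_pair.
Qed.

End observation_laws.

(** * From a finite prior to the minimax risk *)

Section bayes_lower_bounds.
Context d (T : measurableType d) (R : realType) (P : probability T R).
Variables (n : nat) (z : 'I_n -> {RV P >-> R}).
Local Notation mu := (@lebesgue_measure R).
Variables (I : finType) (w : I -> R) (fs Vs : I -> R -> R).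
Hypotheses (w0 : forall i, 0 <= w i) (w1 : \sum_i w i = 1).

Lemma average_le_sup (r : I -> \bar R) (S : \bar R) :
  (forall i, 0 <= r i)%E -> (forall i, r i <= S)%E ->
  (\sum_i (w i)%:E * r i <= S)%E.
Proof.
move=> r0 rS; apply: (@le_trans _ _ (\sum_i (w i)%:E * S)%E).
  by apply: lee_sum => i _; rewrite lee_wpmul2l// lee_fin.
rewrite -ge0_sume_distrl; last by move=> i _; rewrite lee_fin.
by rewrite sumEFin w1 mul1e.
Qed.

Variable Theta : set ((R -> R) * (R -> R)).
Hypothesis Theta_fV : forall i, Theta (fs i, Vs i).

Lemma pointwise_minimax_ge (xs c : R) :
  (forall Vhat, @estimators R n Vhat ->
    (c%:E <= \sum_i (w i)%:E * pointwise_risk z xs Vhat (fs i) (Vs i))%E) ->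
  (c%:E <= minimax Theta (pointwise_risk z xs))%E.
Proof.
move=> h; apply: le_ereal_inf_tmp => _ [Vhat mVhat <-].
apply: (le_trans (h _ mVhat)); apply: average_le_sup => i.
  by apply: integral_ge0 => t _; rewrite lee_fin sqr_ge0.
by apply: ereal_sup_ubound; exists (fs i, Vs i).
Qed.

Lemma measurable_loss (Vhat : n.-tuple R -> R -> R) (f V : R -> R) :
  estimators Vhat -> measurable_fun setT V ->
  measurable_fun ((setT `*` `[0%R, 1%R]%classic) : set (T * measurableTypeR R))
    (fun p : T * measurableTypeR R => ((Vhat (observations z f V p.1) p.2 - V p.2) ^+ 2)%:E).
Proof.
move=> mVhat mV; apply/measurable_EFinP.
have mD : measurable ((setT `*` `[0%R, 1%R]%classic) : set (T * measurableTypeR R)) by exact: measurableX.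
apply: measurable_funX; apply: measurable_funB; last first.
  by apply: measurable_funTS; exact: measurableT_comp.
apply: (@measurable_comp _ _ _ _ _ _ [set p : n.-tuple R * R | p.2 \in `[0, 1]]
  (fun p => Vhat p.1 p.2) _ (fun p : T * measurableTypeR R => (observations z f V p.1, p.2))).
- rewrite (_ : [set p | _] = setT `*` `[0%R, 1%R]%classic); first exact: measurableX.
  by apply/seteqP; split => p /=; [move=> h; split|move=> []].
- by move=> _ [p [_ ?] <-].
- exact: mVhat.
- apply: measurable_funTS; apply: measurable_fun_pair => //.
  by apply: measurableT_comp => //; exact: measurable_observations.
Qed.

(** Tonelli for the loss extended by zero beyond [0, 1], since estimators are measurable only over
    that interval. *)
Lemma global_risk_fubini (Vhat : n.-tuple R -> R -> R) (f V : R -> R) :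
  estimators Vhat -> measurable_fun setT V ->
  measurable_fun (`[0%R, 1%R]%classic : set (measurableTypeR R))
    (fun x : measurableTypeR R => pointwise_risk z x Vhat f V) /\
  (global_risk z Vhat f V =
     \int[mu]_(x in `[0%R, 1%R]) pointwise_risk z x Vhat f V)%E.
Proof.
move=> mVhat mV.
have mD : measurable ((setT `*` `[0%R, 1%R]%classic) : set (T * measurableTypeR R)) by exact: measurableX.
pose F := (fun p : T * measurableTypeR R =>
  ((Vhat (observations z f V p.1) p.2 - V p.2) ^+ 2)%:E).
pose G := F \_ (setT `*` `[0%R, 1%R]%classic).
have mG : measurable_fun setT G.
  exact: ((measurable_restrictT F mD).1 (measurable_loss f mVhat mV)).
have G0 p : (0 <= G p)%E.
  by rewrite /G patchE; case: ifP => // _; rewrite lee_fin sqr_ge0.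
have GE t x : G (t, x) = ((fun x => F (t, x)) \_ `[0%R, 1%R]%classic) x.
  rewrite /G !patchE; congr (if _ then _ else _).
  by apply/idP/idP; rewrite !inE /=; [case|move=> ?; split].
have prE x : fubini_G P G x =
    ((fun x : measurableTypeR R => pointwise_risk z x Vhat f V) \_ `[0%R, 1%R]%classic) x.
  rewrite /fubini_G; under eq_integral do rewrite GE.
  rewrite patchE; case: ifPn => xD.
    by apply: eq_integral => t _; rewrite patchE xD.
  by apply: integral0_eq => t _; rewrite patchE (negbTE xD).
split.
  apply/(measurable_restrictT _ _).2 => //.
  rewrite (_ : _ \_ _ = fubini_G P G); last by apply/funext => x; rewrite prE.
  exact: measurable_fun_fubini_tonelli_G.
transitivity (\int[P]_t \int[mu]_x G (t, x))%E.
  apply: eq_integral => t _; rewrite /sqnorm2 integral_mkcond.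
  by apply: eq_integral => x _; rewrite GE.
rewrite (fubini_tonelli (m1 := P) (m2 := mu) G mG G0).
rewrite [RHS]integral_mkcond; apply: eq_integral => x _.
exact: prE.
Qed.

(** One prior w serves every x, so a pointwise Bayes bound can be integrated in x and the integral
    exchanged with the finite average. *)
Lemma global_minimax_ge (l : R -> R) :
  (forall i, measurable_fun setT (Vs i)) ->
  measurable_fun (`[0%R, 1%R]%classic : set (measurableTypeR R)) l -> (forall x, 0 <= l x) ->
  (forall Vhat, @estimators R n Vhat -> forall x, x \in `[0, 1] ->
    ((l x)%:E <= \sum_i (w i)%:E * pointwise_risk z x Vhat (fs i) (Vs i))%E) ->
  (\int[mu]_(x in `[0%R, 1%R]) (l x)%:E <= minimax Theta (global_risk z))%E.
Proof.
move=> mVs ml l0 h; apply: le_ereal_inf_tmp => _ [Vhat mVhat <-].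
have pr0 i x : (0 <= pointwise_risk z x Vhat (fs i) (Vs i))%E.
  by apply: integral_ge0 => t _; rewrite lee_fin sqr_ge0.
apply: (@le_trans _ _ (\sum_i (w i)%:E * global_risk z Vhat (fs i) (Vs i))%E); last first.
  apply: average_le_sup => i.
    by apply: integral_ge0 => t _; apply: integral_ge0 => x _; rewrite lee_fin sqr_ge0.
  by apply: ereal_sup_ubound; exists (fs i, Vs i).
have mpr i := (global_risk_fubini (fs i) mVhat (mVs i)).1.
apply: (@le_trans _ _ (\int[mu]_(x in `[0%R, 1%R])
    \sum_i (w i)%:E * pointwise_risk z x Vhat (fs i) (Vs i))%E).
  apply: ge0_le_integral => //.
  - by move=> x _; rewrite lee_fin.
  - exact/measurable_EFinP.
  - by apply: emeasurable_sum => i; exact: measurable_funeM.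
  - by move=> x xD; apply: h => //; rewrite inE.
rewrite ge0_integral_sum//; last 2 first.
- by move=> i; exact: measurable_funeM.
- by move=> i x _; rewrite mule_ge0// lee_fin.
apply: lee_sum => i _; rewrite ge0_integralZl//; last by rewrite lee_fin.
by rewrite (global_risk_fubini (fs i) mVhat (mVs i)).2.
Qed.

End bayes_lower_bounds.

(** * Gaussian mixtures with matching moments *)

Section flat_functions.
Context {R : realType}.
Implicit Types (h : R -> R) (p : {poly R}).

(** Vanishing to order n at 0, with at most Gaussian growth: a global bound that survives
    integration against a normal density once t is scaled down. *)
Definition flat (n : nat) h : Prop :=
  exists2 C : R, 0 <= C & forall t, `|h t| <= C * `|t| ^+ n * expR (C * t ^+ 2).

Lemma flatD n h1 h2 : flat n h1 -> flat n h2 -> flat n (fun t => h1 t + h2 t).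
Proof.
move=> [C C0 hC] [D D0 hD]; exists (C + D); first exact: addr_ge0.
move=> t; apply: (le_trans (ler_normD _ _)).
have tn : 0 <= `|t| ^+ n by rewrite exprn_ge0.
have t2 : 0 <= t ^+ 2 by exact: sqr_ge0.
apply: (le_trans (lerD (hC t) (hD t))); rewrite !mulrDl; apply: lerD.
  rewrite ler_wpM2l ?mulr_ge0// ler_expR lerDl mulr_ge0//.
by rewrite ler_wpM2l ?mulr_ge0// ler_expR lerDr mulr_ge0//.
Qed.

Lemma flatM n m h1 h2 : flat n h1 -> flat m h2 ->
  flat (n + m) (fun t => h1 t * h2 t).
Proof.
move=> [C C0 hC] [D D0 hD]; exists (C * D + C + D).
  by rewrite !addr_ge0// mulr_ge0.
move=> t; rewrite normrM.
have tn k : 0 <= `|t| ^+ k by rewrite exprn_ge0.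
have t2 : 0 <= t ^+ 2 by exact: sqr_ge0.
apply: (le_trans (ler_pM _ _ (hC t) (hD t))) => //.
rewrite [leLHS](_ : _ = (C * D) * `|t| ^+ (n + m) * expR (C * t ^+ 2 + D * t ^+ 2));
  last by rewrite expRD exprD [LHS]mulrACA; congr (_ * _); exact: mulrACA.
have CD : 0 <= C * D by rewrite mulr_ge0.
rewrite ler_pM ?mulr_ge0 ?expR_ge0//.
  by rewrite ler_wpM2r// -addrA lerDl addr_ge0.
by rewrite ler_expR -mulrDl ler_wpM2r// -addrA lerDr.
Qed.

Lemma flat_le n h1 h2 : (forall t, `|h1 t| <= `|h2 t|) -> flat n h2 -> flat n h1.
Proof. by move=> h [C C0 hC]; exists C => // t; exact: le_trans (h t) (hC t). Qed.

Lemma flat_cst (c : R) : flat 0 (fun=> c).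
Proof.
exists `|c| => // t; rewrite expr0 mulr1 ler_peMr// -[leLHS]expR0 ler_expR.
by rewrite mulr_ge0// sqr_ge0.
Qed.

Lemma flat_id : flat 1 id.
Proof.
exists 1 => // t; rewrite expr1 !mul1r ler_peMr// -[leLHS]expR0 ler_expR.
exact: sqr_ge0.
Qed.

(** |t| <= 1 + t^2 <= exp(t^2): growth can be traded for the vanishing order. *)
Lemma flat_id0 : flat 0 id.
Proof.
exists 1 => // t; rewrite expr0 !mul1r; apply: le_trans (expR_ge1Dx _).
have : 0 <= (`|t| - 1) ^+ 2 by exact: sqr_ge0.
rewrite -[t ^+ 2]real_normK ?num_real// => h.
have : 0 <= `|t| by [].
by nra.
Qed.

Lemma flatX n h k : flat n h -> flat (n * k) (fun t => h t ^+ k).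
Proof.
move=> hh; elim: k => [|k IH].
  by rewrite muln0; exact: flat_cst.
rewrite mulnS; apply: flat_le (flatM hh IH) => t /=.
by rewrite exprS.
Qed.

Lemma flat_sum n (I : Type) (s : seq I) (F : I -> R -> R) :
  (forall i, flat n (F i)) -> flat n (fun t => \sum_(i <- s) F i t).
Proof.
move=> hF; elim: s => [|i s IH].
  exists 0 => // t; by rewrite big_nil normr0 !mul0r.
by apply: flat_le (flatD (hF i) IH) => t /=; rewrite big_cons.
Qed.

(** The factor |t|^m, large at infinity, is absorbed by the Gaussian factor through [flat_id0]. *)
Lemma flatW n m h : flat (n + m) h -> flat n h.
Proof.
move=> [C C0 hC].
apply: (@flat_le _ _ (fun t => t ^+ n * (t ^+ m * (C * expR (C * t ^+ 2))))).
  move=> t; apply: (le_trans (hC t)).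
  rewrite exprD !normrM !normrX (ger0_norm C0) (ger0_norm (expR_ge0 _)).
  by rewrite le_eqVlt; apply/orP; left; apply/eqP; ring.
have fe : flat 0 (fun t => C * expR (C * t ^+ 2)).
  exists C => // t; rewrite expr0 mulr1 ger0_norm//.
  by rewrite mulr_ge0// expR_ge0.
have := flatM (flatX m flat_id0) fe; rewrite mul0n addn0 => hm.
by have := flatM (flatX n flat_id) hm; rewrite mul1n addn0.
Qed.

Lemma flat_horner p : flat 0 (fun t => p.[t]).
Proof.
apply: (@flat_le _ _ (fun t => \sum_(i <- enum 'I_(size p)) p`_i * t ^+ i)).
  by move=> t; rewrite horner_coef big_enum.
apply: flat_sum => i; apply: (@flatM 0 0); first exact: flat_cst.
by have := flatX i flat_id0; rewrite mul0n.
Qed.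

Lemma flat_expR_quad (c d : R) : flat 0 (fun t => expR (c * t + d * t ^+ 2)).
Proof.
have hc : flat 0 (fun t => expR (c * t)).
  (* From c t <= c^2 + t^2. *)
  exists (expR (c ^+ 2) + 1); first by rewrite addr_ge0// expR_ge0.
  move=> t; rewrite expr0 mulr1 ger0_norm ?expR_ge0//.
  have := expR_gt0 (c ^+ 2); set e := expR (c ^+ 2) => e0.
  apply: (@le_trans _ _ (e * expR (t ^+ 2))).
    rewrite /e -expRD ler_expR.
    have := sqr_ge0 (c - t); have := sqr_ge0 c; have := sqr_ge0 t.
    by nra.
  apply: ler_pM; [exact: ltW|exact: expR_ge0|by rewrite lerDl|].
  by rewrite ler_expR ler_peMl ?sqr_ge0// lerDr ltW.
have hd : flat 0 (fun t => expR (d * t ^+ 2)).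
  exists (`|d| + 1); first by rewrite addr_ge0.
  move=> t; rewrite expr0 mulr1 ger0_norm ?expR_ge0//.
  have := sqr_ge0 t => t2.
  apply: (@le_trans _ _ (expR ((`|d| + 1) * t ^+ 2))).
    rewrite ler_expR ler_wpM2r//; apply: (le_trans (ler_norm _)).
    by rewrite lerDl.
  by rewrite ler_peMl ?expR_ge0// lerDr.
by apply: flat_le (flatM hc hd) => t /=; rewrite expRD.
Qed.

Definition exp_poly n : {poly R} := \poly_(k < n) (k`!%:R)^-1.

Lemma exp_poly_deriv n : (exp_poly n.+1)^`() = exp_poly n.
Proof.
apply/polyP => i; rewrite coef_deriv !coef_poly ltnS.
case: ifP => _; last by rewrite mul0rn.
rewrite -[LHS]mulr_natr factS natrM invfM mulrAC mulVf ?mul1r//.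
Qed.

Lemma exp_poly0 n : (exp_poly n.+1).[0] = 1.
Proof. by rewrite horner_coef0 coef_poly/= fact0 invr1. Qed.

(** Induction by the mean value theorem: the remainder of order n + 1 vanishes at 0 and its
    derivative is the remainder of order n. *)
Lemma exp_poly_rem n x :
  `|expR x - (exp_poly n).[x]| <= `|x| ^+ n * expR `|x|.
Proof.
elim: n x => [|n IH] x.
  rewrite /exp_poly poly_def big_ord0 horner0 subr0 expr0 mul1r.
  by rewrite ger0_norm ?expR_ge0// ler_expR ler_norm.
pose h y := expR y - (exp_poly n.+1).[y].
pose h' y := expR y - (exp_poly n).[y].
have hd (y : R) : is_derive y (1 : R) h (h' y).
  rewrite /h /h' -[exp_poly n]exp_poly_deriv.
  exact: (is_deriveB (is_derive_expR y) (is_derive_poly (exp_poly n.+1) y)).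
have h0 : h 0 = 0 by rewrite /h expR0 exp_poly0 subrr.
have hc : continuous h.
  by move=> y; apply: differentiable_continuous; apply/derivable1_diffP; case: (hd y).
have key c : `|c| <= `|x| -> `|h' c * x| <= `|x| ^+ n.+1 * expR `|x|.
  move=> cx; rewrite normrM exprSr -mulrA [_ * expR _]mulrC mulrA ler_wpM2r//.
  apply: (le_trans (IH c)); rewrite ler_pM ?exprn_ge0 ?expR_ge0 ?ler_expR//.
  by rewrite lerXn2r ?nnegrE.
have [x0|x0] := leP 0 x.
  have [c] := MVT_segment x0 (fun y _ => hd y) (continuous_subspaceT hc).
  rewrite in_itv/= -/(h x) => /andP[c0 cx]; rewrite h0 !subr0 => hx.
  rewrite -/(h x) hx; apply: key.
  by rewrite !ger0_norm.
have [c] := MVT_segment (ltW x0) (fun y _ => hd y) (continuous_subspaceT hc).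
rewrite in_itv/= => /andP[c0 cx]; rewrite h0 !sub0r mulrN => /oppr_inj hx.
rewrite -/(h x) hx; apply: key.
by rewrite ler0_norm// ltr0_norm// lerN2.
Qed.

End flat_functions.

Section moment_matching.
Context {R : realType}.

Definition scaled_exp_poly n (c : R) : {poly R} := \poly_(k < n) (c ^+ k / k`!%:R).

Lemma horner_scaled_exp_poly n c t :
  (scaled_exp_poly n c).[t] = (exp_poly n).[c * t].
Proof.
rewrite !horner_poly; apply: eq_bigr => k _.
by rewrite exprMn; ring.
Qed.

Lemma flat_expR_rem n (c : R) :
  flat n (fun t => expR (c * t) - (scaled_exp_poly n c).[t]).
Proof.
have f1 : flat 0 (fun t => expR (c * t) + expR (- c * t)).
  by apply: flatD; [have := flat_expR_quad c 0|have := flat_expR_quad (- c) 0];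
    apply: flat_le => t; rewrite mul0r addr0.
have f2 : flat n (fun t => (c * t) ^+ n).
  have := flatX n (flatM (flat_cst c) (@flat_id R)).
  by rewrite add0n mul1n.
have := flatM f2 f1; rewrite addn0; apply: flat_le => t.
rewrite horner_scaled_exp_poly; apply: (le_trans (exp_poly_rem _ _)).
rewrite [leRHS]normrM normrX ler_wpM2l ?exprn_ge0//.
rewrite mulNr ger0_norm ?addr_ge0 ?expR_ge0//.
by case: ger0P => _; rewrite (lerDl, lerDr) expR_ge0.
Qed.

Lemma flat_gauss_rem n (c : R) :
  flat n (fun t => expR (c * t ^+ 2) - (exp_poly n).[c * t ^+ 2]).
Proof.
have f1 : flat 0 (fun t => expR (`|c| * t ^+ 2)).
  by have := flat_expR_quad 0 `|c|; apply: flat_le => t; rewrite mul0r add0r.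
have f2 : flat (n + n) (fun t => (c * t ^+ 2) ^+ n).
  have := flatX n (flatM (flat_cst c) (flatX 2 (@flat_id R))).
  by rewrite add0n mul1n mul2n addnn.
have := flatM f2 f1; rewrite addn0 => /flatW; apply: flat_le => t.
apply: (le_trans (exp_poly_rem _ _)).
by rewrite [leRHS]normrM normrX normrM (ger0_norm (sqr_ge0 t)) (ger0_norm (expR_ge0 _)).
Qed.

Lemma flat_poly n (p : {poly R}) : (forall k, (k < n)%N -> p`_k = 0) ->
  flat n (fun t => p.[t]).
Proof.
move=> pn; have := flatM (flatX n (@flat_id R)) (flat_horner (drop_poly n p)).
rewrite mul1n addn0; apply: flat_le => t.
rewrite -[in leLHS](poly_take_drop n p) hornerD.
rewrite (_ : take_poly n p = 0) ?horner0 ?add0r; last first.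
  by apply/polyP => k; rewrite coef_take_poly coef0; case: ifP => // /pn.
by rewrite hornerM hornerXn mulrC.
Qed.

(** exp(eta t^2 / 2) is the moment generating function of N(0, eta). So weights u on the nodes 0,
    ..., q must reproduce the moments up to order q of unit masses at these nodes convolved with
    N(0, eta): a Vandermonde system whose solution is polynomial in eta. *)
Lemma moment_matching (q : nat) : exists (eta : R) (u : 'I_q.+1 -> R),
  [/\ 0 < eta, (forall j, 0 < u j)
    & flat q.+1 (fun t => expR (eta / 2 * t ^+ 2) * (\sum_(j < q.+1) expR (j%:R * t))
        - \sum_(j < q.+1) u j * expR (j%:R * t))].
Proof.
set N := q.+1.
pose V := Vandermonde N (\row_(j < N) (j%:R : R)).
have Vunit : V \in unitmx.
  rewrite unitmxE det_Vandermonde unitfE.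
  apply/prodf_neq0 => i _; apply/prodf_neq0 => j ij.
  by rewrite !mxE subr_eq0 eqr_nat gtn_eqF.
pose W := invmx V.
pose B := \sum_(j < N) scaled_exp_poly N j%:R.
(* The coefficient of eta^l in weight j: the term (eta t^2 / 2)^l / l! of the exponential
   contributes the coefficient of t^k in t^(2 l) B. *)
pose cf (j : 'I_N) (l : nat) : R :=
  \sum_(k < N) W j k * (k`!%:R * ((l`!%:R)^-1 * 2^-1 ^+ l * ('X^(2 * l) * B)`_k)).
pose U j : {poly R} := \poly_(l < N) cf j l.
have U0 j : (U j).[0] = 1.
  rewrite horner_coef0 coef_poly/= /cf.
  have VW : (W *m V *m const_mx 1 : 'cV_N) j 0 = 1.
    by rewrite mulVmx// mul1mx mxE.
  rewrite -[RHS]VW -mulmxA mxE; apply: eq_bigr => k _; congr (_ * _).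
  rewrite fact0 expr0 invr1 muln0 !mul1r /B coef_sum mxE mulr_sumr.
  apply: eq_bigr => i _; rewrite coef_poly ltn_ord !mxE mulr1.
  by rewrite mulrC divfK// pnatr_eq0 -lt0n fact_gt0.
pose C j := sval (cid2 (poly_unit_bounds (U j))).
have C0 j : 0 <= C j by rewrite /C; case: cid2.
have CL j x y : 0 <= x <= 1 -> 0 <= y <= 1 ->
    `|(U j).[y] - (U j).[x]| <= C j * `|y - x|.
  by rewrite /C; case: cid2 => D ? h /= hx hy; have [] := h x y hx hy.
have SC : 0 <= \sum_(j < N) C j by exact: sumr_ge0.
(* [U j] equals 1 at 0 and moves by at most C j times eta, which is below 1 for this eta; hence the
   weights are positive. *)
pose eta := (1 + \sum_(j < N) C j)^-1.
have eta0 : 0 < eta by rewrite invr_gt0 ltr_wpDr.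
have eta1 : eta <= 1 by rewrite invf_le1 ?lerDl// ltr_wpDr.
exists eta, (fun j => (U j).[eta]); split=> //.
  move=> j; have := CL j 0 eta; rewrite U0 subr0 lexx ler01 (ltW eta0) eta1.
  move=> /(_ isT isT); rewrite (gtr0_norm eta0) => h.
  have : C j * eta < 1.
    rewrite ltr_pdivrMr ?ltr_wpDr// mul1r (bigD1 j)//=.
    set T := (X in C j + X); have : 0 <= T by exact: sumr_ge0.
    by lra.
  by move: h; rewrite ler_norml => /andP[]; lra.
pose G : {poly R} := \sum_(l < N) ((l`!%:R)^-1 * (eta / 2) ^+ l) *: 'X^(2 * l).
pose A := \sum_(j < N) (U j).[eta] *: scaled_exp_poly N j%:R.
have GE t : G.[t] = (exp_poly N).[eta / 2 * t ^+ 2].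
  rewrite horner_poly horner_sum; apply: eq_bigr => l _.
  by rewrite hornerZ hornerXn exprM [in RHS]exprMn mulrA.
have UE j : (U j).[eta] = \sum_(k < N) W j k * (k`!%:R * (G * B)`_k).
  rewrite horner_poly /cf; under eq_bigr do rewrite mulr_suml.
  rewrite exchange_big/=; apply: eq_bigr => k _.
  rewrite /G mulr_suml coef_sum !mulr_sumr; apply: eq_bigr => l _.
  rewrite -[_ *: 'X^(2 * l) * B]scalerAl coefZ [(eta / 2) ^+ l]exprMn; ring.
(* Coefficient k of G B - A, multiplied by k!, vanishes by row k of the Vandermonde system. *)
have key : flat N (fun t => (G * B - A).[t]).
  apply: flat_poly => k kN; rewrite coefB /A coef_sum; apply/eqP.
  rewrite subr_eq0; apply/eqP; pose k' := Ordinal kN.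
  have VW : (V *m (W *m (\col_i (i`!%:R * (G * B)`_i)))) k' 0
      = k`!%:R * (G * B)`_k by rewrite mulmxA mulmxV// mul1mx mxE.
  have f0 : k`!%:R != 0 :> R by rewrite pnatr_eq0 -lt0n fact_gt0.
  apply: (mulfI f0); rewrite -VW mxE [RHS]mulr_sumr; apply: eq_bigr => j _.
  rewrite coefZ coef_poly kN UE !mxE.
  rewrite (eq_bigr (fun i => W j i * (i`!%:R * (G * B)`_i))); last first.
    by move=> i _; rewrite mxE.
  by field.
have flatB : flat 0 (fun t => \sum_(j < N) expR (j%:R * t) : R).
  apply: flat_sum => j; have := flat_expR_quad (j%:R : R) 0.
  by apply: flat_le => t; rewrite mul0r addr0.
have remB : flat N (fun t => \sum_(j < N) expR (j%:R * t) - B.[t]).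
  have := @flat_sum _ N _ (index_enum 'I_N) _ (fun j : 'I_N => flat_expR_rem N j%:R).
  by apply: flat_le => t; rewrite /B horner_sum -sumrB.
have remA : flat N (fun t => \sum_(j < N) (U j).[eta] * expR (j%:R * t) - A.[t]).
  have := @flat_sum _ N _ (index_enum 'I_N) _
    (fun j : 'I_N => flatM (flat_cst (U j).[eta]) (flat_expR_rem N j%:R)).
  apply: flat_le => t; rewrite /A horner_sum -sumrB.
  by under eq_bigr do rewrite hornerZ -mulrBr.
have remG := flatM (flat_gauss_rem N (eta / 2)) flatB.
have remGB := flatM (flat_horner G) remB.
have remNA := flatM (flat_cst (- 1)) remA.
rewrite addn0 in remG; rewrite add0n in remGB remNA.
(* The three Taylor errors, of the Gaussian factor, of the equal-weight sum and of the sum with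
   weights u, leave the polynomial G B - A. *)
apply: flat_le (flatD (flatD remG remGB) (flatD key remNA)) => t.
rewrite le_eqVlt; apply/orP; left; apply/eqP; congr `|_|.
by rewrite -GE hornerD hornerN hornerM; ring.
Qed.

End moment_matching.

(** * Chi-square bounds for normal laws and for densities known up to a factor *)

Section gaussian_chi_square.
Context {R : realType}.
Local Notation mu := (@lebesgue_measure R).
Local Notation prob := (probability (measurableTypeR R) R).

Lemma measurable_inv (f : R -> R) : measurable_fun setT f -> (forall x, 0 < f x) ->
  measurable_fun setT (fun x => (f x)^-1).
Proof.
move=> mf f0; rewrite (_ : (fun x => (f x)^-1) = (fun y => y `^ (-1)) \o f).
  by apply: measurableT_comp => //; exact: measurable_powR.
by apply/funext => x /=; rewrite powR_inv1// ltW.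
Qed.

Lemma normal_peakE (s : R) : 0 < s -> normal_peak s = s^-1 * normal_peak 1.
Proof.
move=> s0; rewrite /normal_peak -!mulrnAr (sqrtrM _ (sqr_ge0 s)) (sqrtrM _ (sqr_ge0 1)).
by rewrite !sqrtr_sqr (gtr0_norm s0) normr1 mul1r invfM.
Qed.

Lemma normal_pdf_gt0 (m s x : R) : 0 < s -> 0 < normal_pdf m s x.
Proof.
move=> s0; rewrite normal_pdfE ?gt_eqF// mulr_gt0 ?expR_gt0//.
by rewrite normal_peak_gt0// gt_eqF.
Qed.

Lemma has_density_normal (m s : R) : has_density (normal_prob m s : prob) (normal_pdf m s).
Proof.
split; [exact: measurable_normal_pdf|exact: normal_pdf_ge0|].
by move=> A mA.
Qed.

Lemma has_density_mixture (I : finType) (w : I -> R) (Q : I -> prob)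
    (p : I -> R -> R) (nu : prob) :
  (forall i, 0 <= w i) -> (forall i, has_density (Q i) (p i)) ->
  (forall A, measurable A -> nu A = (\sum_i (w i)%:E * Q i A)%E) ->
  has_density nu (fun x => \sum_i w i * p i x).
Proof.
move=> w0 dQ nuE; split.
- by apply: measurable_sum => i; apply: measurable_funM => //; case: (dQ i).
- by move=> x; apply: sumr_ge0 => i _; rewrite mulr_ge0//; case: (dQ i).
move=> A mA; rewrite nuE//.
under eq_integral do rewrite -sumEFin.
rewrite ge0_integral_sum//; last 2 first.
- move=> i; apply/measurable_EFinP; apply: measurable_funTS; apply: measurable_funM => //.
  by case: (dQ i).
- by move=> i x _; rewrite lee_fin mulr_ge0//; case: (dQ i).
apply: eq_bigr => i _; have [mp p0 ->//] := dQ i.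
rewrite -ge0_integralZl//.
- by apply/measurable_EFinP; exact: measurable_funTS.
- by move=> x _; rewrite lee_fin.
- by rewrite lee_fin.
Qed.

Lemma has_density_integral (nu : prob) p : has_density nu p ->
  (\int[mu]_x (p x)%:E = 1)%E.
Proof. by move=> [_ _ h]; rewrite -h// probability_setT. Qed.

(** p1^2 / p0 is a multiple k of a centred normal density of precision 2 / s1^2 - 1 / s0^2, positive
    because |r| < 1. Its integral k = (1 - r^2)^(-1/2) is at most 1 + r^2 as long as r^2 <= 1/2. *)
Lemma normal_square_dominated (s0 s1 : R) : 0 < s0 -> 0 < s1 ->
  (s1 ^+ 2 / s0 ^+ 2 - 1) ^+ 2 <= 1 / 2 ->
  square_dominated (1 + (s1 ^+ 2 / s0 ^+ 2 - 1) ^+ 2)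
    (normal_prob 0 s0 : prob) (normal_prob 0 s1).
Proof.
move=> s00 s10; set r := s1 ^+ 2 / s0 ^+ 2 - 1 => r2.
have s0n : s0 != 0 by rewrite gt_eqF.
have s1n : s1 != 0 by rewrite gt_eqF.
have s1E : s1 ^+ 2 = s0 ^+ 2 * (1 + r) by rewrite /r; field.
have rlt1 : `|r| < 1.
  by rewrite -(@ltr_pXn2r _ 2)// ?nnegrE// expr1n real_normK ?num_real//; lra.
have [r1 r1'] : -1 < r /\ r < 1 by move: rlt1; rewrite ltr_norml => /andP[].
have q0 : 0 < (1 + r) / (1 - r) by rewrite divr_gt0//; lra.
pose s2 := s0 * Num.sqrt ((1 + r) / (1 - r)).
have s20 : 0 < s2 by rewrite mulr_gt0// sqrtr_gt0.
have s2n : s2 != 0 by rewrite gt_eqF.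
have s2E : s2 ^+ 2 = s0 ^+ 2 * ((1 + r) / (1 - r)).
  by rewrite exprMn sqr_sqrtr// ltW.
have r10 : 1 + r != 0 by rewrite gt_eqF//; lra.
have r20 : 1 - r != 0 by rewrite gt_eqF//; lra.
have s1V : (s1 ^+ 2)^-1 = (s0 ^+ 2)^-1 * (1 + r)^-1 by rewrite s1E invfM.
have s2V : (s2 ^+ 2)^-1 = (s0 ^+ 2)^-1 * ((1 - r) * (1 + r)^-1).
  by rewrite s2E invfM invf_div.
pose k := s0 * s2 / s1 ^+ 2.
have k0 : 0 <= k by rewrite divr_ge0 ?sqr_ge0// mulr_ge0// ltW.
have pE x : normal_pdf 0 s1 x ^+ 2 / normal_pdf 0 s0 x = k * normal_pdf 0 s2 x.
  rewrite !normal_pdfE// /normal_fun !(normal_peakE s00, normal_peakE s10, normal_peakE s20).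
  have e : expR (- (x - 0) ^+ 2 / (s1 ^+ 2 *+ 2)) ^+ 2 =
      expR (- (x - 0) ^+ 2 / (s0 ^+ 2 *+ 2)) * expR (- (x - 0) ^+ 2 / (s2 ^+ 2 *+ 2)).
    rewrite -expRM_natl -expRD; congr expR.
    rewrite -(mulr_natr (s1 ^+ 2)) -(mulr_natr (s0 ^+ 2)) -(mulr_natr (s2 ^+ 2)).
    rewrite (invfM (s1 ^+ 2)) (invfM (s0 ^+ 2)) (invfM (s2 ^+ 2)) s2V s1V; move: (- (x - 0) ^+ 2) ((s0 ^+ 2)^-1) => t v.
    have -> : v * ((1 - r) / (1 + r)) = v * (2 * (1 + r)^-1 - 1).
      by congr (_ * _); field.
    by field.
  have p10 : normal_peak 1 != 0 :> R by rewrite gt_eqF// normal_peak_gt0// oner_eq0.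
  rewrite exprMn e /k; have := expR_gt0 (- (x - 0) ^+ 2 / (s0 ^+ 2 *+ 2)).
  move: (expR _) (expR _) (normal_peak 1) p10 => e0 e2 p1 p10 /lt0r_neq0 e00.
  by field; rewrite p10 s0n s1n s2n e00.
have k1 : k <= 1 + r ^+ 2.
  have sr := sqr_ge0 r.
  rewrite -(@ler_pXn2r _ 2)// ?nnegrE//; last by lra.
  rewrite /k exprMn exprVn exprMn s2E s1E.
  have -> : s0 ^+ 2 * (s0 ^+ 2 * ((1 + r) / (1 - r))) / (s0 ^+ 2 * (1 + r)) ^+ 2 =
      ((1 + r) * (1 - r))^-1.
    by field; rewrite s0n r10 r20.
  rewrite -div1r ler_pdivrMr; last by rewrite mulr_gt0; lra.
  have -> : (1 + r ^+ 2) ^+ 2 * ((1 + r) * (1 - r)) =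
    1 + r ^+ 2 * (1 - r ^+ 2 - (r ^+ 2) ^+ 2) by ring.
  rewrite lerDl mulr_ge0//; move: sr r2; set t := r ^+ 2 => sr r2.
  by rewrite expr2; nra.
apply: (density_square_dominated (has_density_normal 0 s0) (has_density_normal 0 s1)).
- by move=> x; exact: normal_pdf_gt0.
- by rewrite ltr_pwDl// sqr_ge0.
- rewrite (_ : (fun _ => _) = (fun x => k * normal_pdf 0 s2 x)).
    by apply: measurable_funM => //; exact: measurable_normal_pdf.
  by apply/funext.
under eq_integral do rewrite pE EFinM.
have mE : measurable_fun setT (fun x => (normal_pdf 0 s2 x)%:E).
  by apply/measurable_EFinP; exact: measurable_normal_pdf.
have n0 x : setT x -> (0 <= (normal_pdf 0 s2 x)%:E)%E by rewrite lee_fin normal_pdf_ge0.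
have k0E : (0 <= k%:E)%E by rewrite lee_fin.
rewrite (ge0_integralZl mu measurableT mE n0 k0E).
by rewrite integral_normal_pdf mule1 lee_fin.
Qed.

(** With rho = Z0 / Z1, expanding the square gives the integral of p1^2 / p0 as 2 rho - rho^2 plus
    the scaled integral of (q1 - q0)^2 / q0. Since 2 rho - rho^2 <= 1, unequal normalizing constants
    do no harm. *)
Lemma chi_square_dominated (nu0 nu1 : prob) (q0 q1 : R -> R) (Z0 Z1 X : R) :
  0 < Z0 -> 0 < Z1 -> 0 <= X -> (forall x, 0 < q0 x) ->
  has_density nu0 (fun x => q0 x / Z0) -> has_density nu1 (fun x => q1 x / Z1) ->
  measurable_fun setT q0 -> measurable_fun setT q1 ->
  (\int[mu]_x ((q1 x - q0 x) ^+ 2 / q0 x)%:E <= X%:E)%E ->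
  square_dominated (1 + Z0 * X / Z1 ^+ 2) nu0 nu1.
Proof.
move=> Z00 Z10 X0 q00 d0 d1 mq0 mq1 hX.
have Z0n : Z0 != 0 by rewrite gt_eqF.
have Z1n : Z1 != 0 by rewrite gt_eqF.
have mV := measurable_inv mq0 q00.
have p00 x : 0 < q0 x / Z0 by rewrite divr_gt0.
have [mp0 p0ge0 _] := d0; have [mp1 p1ge0 _] := d1.
have mp : measurable_fun setT (fun x => (q1 x / Z1) ^+ 2 / (q0 x / Z0)).
  by apply: measurable_funM; [exact: measurable_funX|exact: measurable_inv].
have mchi : measurable_fun setT (fun x => (q1 x - q0 x) ^+ 2 / q0 x).
  by apply: measurable_funM => //; apply: measurable_funX; exact: measurable_funB.
have chi0 x : 0 <= (q1 x - q0 x) ^+ 2 / q0 x by rewrite divr_ge0 ?sqr_ge0// ltW.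
have K1 : 1 <= 1 + Z0 * X / Z1 ^+ 2.
  by rewrite lerDl divr_ge0 ?sqr_ge0// mulr_ge0// ltW.
apply: (density_square_dominated d0 d1) => //; first exact: lt_le_trans K1.
have pp0 x : 0 <= (q1 x / Z1) ^+ 2 / (q0 x / Z0) by rewrite divr_ge0 ?sqr_ge0.
set J := (X in (X <= _)%E).
pose rho := Z0 / Z1.
have rho0 : 0 <= rho by rewrite divr_ge0// ltW.
have r2 : 0 <= rho ^+ 2 by exact: sqr_ge0.
have c0 : 0 <= Z0 / Z1 ^+ 2 by rewrite divr_ge0 ?sqr_ge0// ltW.
have intZ (c : R) (f : R -> R) : 0 <= c -> measurable_fun setT f -> (forall x, 0 <= f x) ->
    (\int[mu]_x (c * f x)%:E = c%:E * \int[mu]_x (f x)%:E)%E.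
  move=> cge mf f0; under eq_integral do rewrite EFinM.
  by rewrite ge0_integralZl//; [exact/measurable_EFinP|move=> x _; rewrite lee_fin].
have intD (f g : R -> R) : measurable_fun setT f -> measurable_fun setT g ->
    (forall x, 0 <= f x) -> (forall x, 0 <= g x) ->
    (\int[mu]_x (f x + g x)%:E = \int[mu]_x (f x)%:E + \int[mu]_x (g x)%:E)%E.
  move=> mf mg f0 g0; under eq_integral do rewrite EFinD.
  by rewrite ge0_integralD//; do ?[exact/measurable_EFinP|move=> x _; rewrite lee_fin].
(* [rho ^+ 2] stays on the left to avoid a subtraction while J may still be infinite. *)
have key : (J + (rho ^+ 2)%:E = (2 * rho)%:E + (Z0 / Z1 ^+ 2)%:E *
    \int[mu]_x ((q1 x - q0 x) ^+ 2 / q0 x)%:E)%E.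
  rewrite -[(rho ^+ 2)%:E]mule1 -[(2 * rho)%:E]mule1.
  rewrite -[in LHS](has_density_integral d0) -[in RHS](has_density_integral d1).
  have t0 : 0 <= 2 * rho by rewrite mulr_ge0.
  rewrite -!intZ//.
  rewrite /J -!intD//; try exact: measurable_funM;
    try (by move=> x; apply: mulr_ge0 => //; (exact: p0ge0 || exact: p1ge0)).
  apply: eq_integral => x _; congr EFin.
  by rewrite /rho; field; rewrite Z0n Z1n gt_eqF.
have hle : (J + (rho ^+ 2)%:E <= (2 * rho + Z0 / Z1 ^+ 2 * X)%:E)%E.
  rewrite key EFinD [(Z0 / Z1 ^+ 2 * X)%:E]EFinM leeD2l//.
  by apply: lee_wpmul2l => //; rewrite lee_fin.
move: hle; rewrite -leeBrDr// => hle; apply: (le_trans hle).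
rewrite -EFinB lee_fin mulrAC; have := sqr_ge0 (rho - 1).
by rewrite sqrrB1; move: (_ * X) => Y; lra.
Qed.

End gaussian_chi_square.

Section gaussian_mixtures.
Context {R : realType}.
Local Notation mu := (@lebesgue_measure R).
Local Notation prob := (probability (measurableTypeR R) R).

Lemma expRXn_le (x : R) n : 0 <= x -> x ^+ n <= n`!%:R * expR x.
Proof.
move=> x0; case: n => [|n]; first by rewrite expr0 fact0 mul1r -[leLHS]expR0 ler_expR.
have := expR_ge1Dxn n x0.
have f0 : 0 < (n.+1)`!%:R :> R by rewrite ltr0n fact_gt0.
rewrite -ler_pdivrMl// mulrC; apply: le_trans.
by rewrite lerDr.
Qed.

(** The prefactor will be moved into the mixing weights, which leaves the likelihood ratio exp(t y /
    s) against N(0, s^2). *)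
Lemma normal_pdf_tilt0 (s t y : R) : 0 < s ->
  expR (t ^+ 2 / 2) * normal_pdf (s * t) s y = normal_pdf 0 s y * expR (t * (y / s)).
Proof.
move=> s0; have sn : s != 0 by rewrite gt_eqF.
rewrite !normal_pdfE// /normal_fun mulrCA -[RHS]mulrA -!expRD; congr (_ * expR _).
rewrite -(mulr_natr (s ^+ 2)); field; exact: sn.
Qed.

(** The mean s t / c^2 is chosen so that variance s^2 / c^2 yields the same linear exponent t y / s;
    what remains is a quadratic factor free of t. *)
Lemma normal_pdf_tilt1 (s c t y : R) : 0 < s -> 0 < c ->
  c^-1 * expR (t ^+ 2 / (2 * c ^+ 2)) * normal_pdf (s * t / c ^+ 2) (s / c) y =
  normal_pdf 0 s y * (expR ((1 - c ^+ 2) / 2 * (y / s) ^+ 2) * expR (t * (y / s))).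
Proof.
move=> s0 c0; have sn : s != 0 by rewrite gt_eqF.
have cn : c != 0 by rewrite gt_eqF.
have sc0 : 0 < s / c by rewrite divr_gt0.
rewrite !normal_pdfE ?gt_eqF// /normal_fun (normal_peakE s0) (normal_peakE sc0).
have -> : expR (- (y - 0) ^+ 2 / (s ^+ 2 *+ 2)) =
    expR (- y ^+ 2 / (s ^+ 2 * 2)) by rewrite subr0 -(mulr_natr (s ^+ 2)).
have -> : expR (- (y - s * t / c ^+ 2) ^+ 2 / ((s / c) ^+ 2 *+ 2)) =
  expR (- y ^+ 2 / (s ^+ 2 * 2)) * (expR ((1 - c ^+ 2) / 2 * (y / s) ^+ 2) *
    expR (t * (y / s))) * expR (- (t ^+ 2 / (2 * c ^+ 2))).
  rewrite -!expRD -(mulr_natr ((s / c) ^+ 2)); congr expR.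
  by field; rewrite sn cn.
rewrite expRN; have := expR_gt0 (t ^+ 2 / (2 * c ^+ 2)) => /lt0r_neq0.
move: (expR (t ^+ 2 / _)) (expR (- y ^+ 2 / _)) (expR (_ * (y / s) ^+ 2)) (expR (t * _))
  (normal_peak 1) => e1 e2 e3 e4 p en.
by field; rewrite sn cn en.
Qed.

(** Doubling the variance gains exp(x^2 / 4), x = y / s. One half of the exponent absorbs x^(2 n),
    at the price n! 8^n; the other absorbs exp(2 C a^2 x^2) once 16 C a^2 <= 1. *)
Lemma flat_chi_bound (n : nat) (D : R -> R) : flat n D ->
  exists C a0 : R, [/\ 0 < C, 0 < a0 & forall a s y, 0 < a <= a0 -> 0 < s ->
    normal_pdf 0 s y * D (a * (y / s)) ^+ 2 <=
    C * a ^+ (n * 2) * normal_pdf 0 (Num.sqrt 2 * s) y].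
Proof.
move=> [C C0 hC].
have q2 : 0 < Num.sqrt 2 :> R by rewrite sqrtr_gt0.
exists ((C ^+ 2 + 1) * n`!%:R * 8 ^+ n * Num.sqrt 2), (Num.sqrt ((16 * (C + 1))^-1)).
have C1 : 0 < C ^+ 2 + 1 by rewrite ltr_wpDl// sqr_ge0.
have f0 : 0 < n`!%:R :> R by rewrite ltr0n fact_gt0.
have c0 : 0 < C + 1 by rewrite ltr_wpDl.
have e80 : 0 < 8 ^+ n :> R by rewrite exprn_gt0.
split.
- by rewrite !mulr_gt0.
- by rewrite sqrtr_gt0 invr_gt0 mulr_gt0.
move=> a s y /andP[a0 ha] s0.
have sn : s != 0 by rewrite gt_eqF.
have a2 : 16 * (C + 1) * a ^+ 2 <= 1.
  rewrite -ler_pdivlMl ?mulr_gt0// mulr1 -[leRHS]sqr_sqrtr; last first.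
    by rewrite invr_ge0 ltW// mulr_gt0.
  by rewrite lerXn2r ?nnegrE ?sqrtr_ge0// ltW.
pose x := y / s; have x2 := sqr_ge0 x.
have sq0 : 0 < Num.sqrt 2 * s by rewrite mulr_gt0.
have -> : normal_pdf 0 (Num.sqrt 2 * s) y =
    normal_pdf 0 s y * ((Num.sqrt 2)^-1 * expR (x ^+ 2 / 4)).
  rewrite !normal_pdfE ?(gt_eqF sq0) ?(gt_eqF s0)// /normal_fun (normal_peakE s0) (normal_peakE sq0).
  have -> : - (y - 0) ^+ 2 / ((Num.sqrt 2 * s) ^+ 2 *+ 2) =
      - (y - 0) ^+ 2 / (s ^+ 2 *+ 2) + x ^+ 2 / 4.
    rewrite exprMn sqr_sqrtr// /x -(mulr_natr (2 * _)) -(mulr_natr (s ^+ 2)).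
    by field.
  rewrite expRD invfM; ring.
have p0 : 0 <= normal_pdf 0 s y by exact: normal_pdf_ge0.
rewrite [leRHS]mulrCA ler_wpM2l//.
rewrite [leRHS](_ : _ = (C ^+ 2 + 1) * n`!%:R * 8 ^+ n * a ^+ (n * 2) * expR (x ^+ 2 / 4));
  last by field; rewrite gt_eqF.
have := hC (a * x); rewrite -/x => h.
have h2 : D (a * x) ^+ 2 <= (C * `|a * x| ^+ n * expR (C * (a * x) ^+ 2)) ^+ 2.
  by rewrite -real_normK ?num_real// lerXn2r ?nnegrE// (le_trans _ h).
apply: (le_trans h2).
have -> : (C * `|a * x| ^+ n * expR (C * (a * x) ^+ 2)) ^+ 2 =
    C ^+ 2 * (8 ^+ n * (x ^+ 2 / 8) ^+ n) * a ^+ (n * 2) *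
    expR (2 * (C * (a * x) ^+ 2)).
  have -> : 8 ^+ n * (x ^+ 2 / 8) ^+ n = (x ^+ 2) ^+ n.
    by rewrite -exprMn; congr (_ ^+ _); field.
  have ea : (`|a * x| ^+ n) ^+ 2 = a ^+ (n * 2) * (x ^+ 2) ^+ n.
    by rewrite -exprM [(n * 2)%N]mulnC !exprM real_normK ?num_real// (exprMn 2) exprMn.
  by rewrite (exprMn 2) (exprMn 2) ea expRM_natl; ring.
have x80 : 0 <= x ^+ 2 / 8 by rewrite divr_ge0.
have e1 := expRXn_le n x80.
have e2 : expR (2 * (C * (a * x) ^+ 2)) <= expR (x ^+ 2 / 8).
  rewrite ler_expR exprMn.
  have : 0 <= a ^+ 2 * x ^+ 2 by rewrite mulr_ge0 ?sqr_ge0.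
  have := ler_wpM2r x2 a2.
  by move: (a ^+ 2) (x ^+ 2) => A X; lra.
have -> : expR (x ^+ 2 / 4) = expR (x ^+ 2 / 8) * expR (x ^+ 2 / 8).
  by rewrite -expRD; congr expR; field.
have ap : 0 <= a ^+ (n * 2) by rewrite exprn_ge0// ltW.
have E0 := expR_gt0 (x ^+ 2 / 8).
move: e1 e2 E0; move: (expR (x ^+ 2 / 8)) (expR _) (expR_ge0 (2 * (C * (a * x) ^+ 2)))
  => E F F0 e1 e2 E0.
have xn0 : 0 <= (x ^+ 2 / 8) ^+ n by rewrite exprn_ge0.
apply: (@le_trans _ _ (C ^+ 2 * (8 ^+ n * (n`!%:R * E)) * a ^+ (n * 2) * E)).
  apply: ler_pM => //.
    by rewrite !mulr_ge0// ?sqr_ge0// ltW.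
  by rewrite ler_wpM2r// ler_wpM2l ?sqr_ge0// ler_wpM2l// ltW.
rewrite -subr_ge0 (_ : _ - _ = n`!%:R * 8 ^+ n * a ^+ (n * 2) * (E * E)); last by ring.
by rewrite !mulr_ge0// ltW.
Qed.

End gaussian_mixtures.

Section moment_matched_mixtures.
Context {R : realType}.
Local Notation mu := (@lebesgue_measure R).
Local Notation prob := (probability (measurableTypeR R) R).

Lemma square_dominatedW (K K' : R) (nu0 nu1 : prob) : K <= K' ->
  square_dominated K nu0 nu1 -> square_dominated K' nu0 nu1.
Proof.
move=> KK h g mg g01; apply: (le_trans (h g mg g01)).
apply: lee_wpmul2r; last by rewrite lee_fin.
by apply: integral_ge0 => x _; rewrite lee_fin sqr_ge0.
Qed.

(** [nu0] uses the solved weights u, [nu1] equal weights and the larger variance, both tilted so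
    that the unnormalized densities differ by the N(0, s^2) density times D(a y / s). The terms j =
    0 keep the denominators away from 0: they give A >= [u ord0] and Z1 >= 1. *)
Lemma mixture_square_dominated (q : nat) : exists eta a0 C : R,
  [/\ 0 < eta, 0 < a0, 0 < C & forall a s, 0 < a <= a0 -> 0 < s ->
    eta * a ^+ 2 <= 1 / 2 /\
    exists w0 w1 : 'I_q.+1 -> R,
      [/\ (forall j, 0 <= w0 j) /\ \sum_j w0 j = 1,
        (forall j, 0 <= w1 j) /\ \sum_j w1 j = 1
      & forall nu0 nu1 : prob,
        (forall A, measurable A ->
          nu0 A = (\sum_j (w0 j)%:E * normal_prob (s * (a * j%:R)) s A)%E) ->
        (forall A, measurable A ->
          nu1 A = (\sum_j (w1 j)%:E * normal_prob (s * (a * j%:R) / (1 - eta * a ^+ 2))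
            (s / Num.sqrt (1 - eta * a ^+ 2)) A)%E) ->
        square_dominated (1 + C * a ^+ (q.+1 * 2)) nu0 nu1]].
Proof.
have [eta [u [eta0 u0 fD]]] := @moment_matching R q.
set D := (D in flat _ D) in fD.
have [C1 [a1 [C10 a10 hchi]]] := flat_chi_bound fD.
pose Zmax := \sum_(j < q.+1) u j * expR (j%:R ^+ 2 / 2).
have sum_ge (F : 'I_q.+1 -> R) : (forall j, 0 <= F j) -> F ord0 <= \sum_j F j.
  by move=> F0; rewrite (bigD1 ord0)//= lerDl sumr_ge0.
have Zmax0 : 0 < Zmax.
  have h := sum_ge (fun j => u j * expR (j%:R ^+ 2 / 2)).
  apply: lt_le_trans (h _); first by rewrite mulr_gt0 ?expR_gt0.
  by move=> j; rewrite mulr_ge0 ?expR_ge0// ltW.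
have e20 : 0 < (1 + 2 * eta)^-1 by rewrite invr_gt0; lra.
(* a <= 1 / (1 + 2 eta) gives a <= 1, which bounds Z0 by [Zmax], and eta a^2 <= 1/2, which keeps the
   larger variance below 2 s^2. *)
exists eta, (Num.min a1 (1 + 2 * eta)^-1), (Zmax * (C1 / u ord0)).
split=> //; first by rewrite lt_min a10 e20.
  by rewrite mulr_gt0// divr_gt0.
move=> a s /andP[agt0 +] s0; rewrite le_min => /andP[aa1 aeta].
have ale : a * (1 + 2 * eta) <= 1 by rewrite -ler_pdivlMr ?mul1r//; lra.
have a1le : a <= 1.
  by apply: (le_trans aeta); rewrite invf_le1; lra.
have etaa : eta * a ^+ 2 <= 1 / 2.
  have : eta * a * a <= eta * a * 1 by rewrite ler_wpM2l// mulr_ge0// ltW.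
  by rewrite expr2; lra.
split=> //.
set c := Num.sqrt _.
have c2 : c ^+ 2 = 1 - eta * a ^+ 2 by rewrite sqr_sqrtr//; lra.
have c0 : 0 < c by rewrite sqrtr_gt0; lra.
have c1 : c <= 1.
  rewrite -(@ler_pXn2r _ 2)// ?nnegrE ?(ltW c0)// c2 expr1n.
  by have := mulr_ge0 (ltW eta0) (sqr_ge0 a); lra.
pose W0 (j : 'I_q.+1) := u j * expR ((a * j%:R) ^+ 2 / 2).
pose W1 (j : 'I_q.+1) := c^-1 * expR ((a * j%:R) ^+ 2 / (2 * c ^+ 2)).
have W00 j : 0 < W0 j by rewrite mulr_gt0 ?expR_gt0.
have W10 j : 0 < W1 j by rewrite mulr_gt0 ?expR_gt0// invr_gt0.
pose Z0 := \sum_j W0 j; pose Z1 := \sum_j W1 j.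
have Z00 : 0 < Z0 by apply: lt_le_trans (sum_ge _ (fun j => ltW (W00 j))).
have Z1ge1 : 1 <= Z1.
  apply: le_trans (sum_ge _ (fun j => ltW (W10 j))).
  by rewrite /W1 mulr0 expr0n/= mul0r expR0 mulr1 invf_ge1.
have Z10 : 0 < Z1 by exact: lt_le_trans Z1ge1.
have Z0le : Z0 <= Zmax.
  apply: ler_sum => j _; rewrite ler_wpM2l ?(ltW (u0 j))// ler_expR ler_wpM2r//.
  rewrite exprMn ler_piMl ?sqr_ge0// expr2.
  by rewrite mulr_ile1// ltW.
exists (fun j => W0 j / Z0), (fun j => W1 j / Z1); split.
- split=> [j|]; first by rewrite divr_ge0// ltW.
  by rewrite -mulr_suml divff// gt_eqF.
- split=> [j|]; first by rewrite divr_ge0// ltW.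
  by rewrite -mulr_suml divff// gt_eqF.
move=> nu0 nu1 nu0E nu1E.
pose q0 y := \sum_j W0 j * normal_pdf (s * (a * j%:R)) s y.
pose q1 y := \sum_j W1 j * normal_pdf (s * (a * j%:R) / (1 - eta * a ^+ 2)) (s / c) y.
have nd0 j := has_density_normal (s * (a * j%:R)) s.
have nd1 j := has_density_normal (s * (a * j%:R) / (1 - eta * a ^+ 2)) (s / c).
have d0 : has_density nu0 (fun y => q0 y / Z0).
  have := has_density_mixture (fun j : 'I_q.+1 => divr_ge0 (ltW (W00 j)) (ltW Z00))
    (fun j : 'I_q.+1 => nd0 j) nu0E.
  by congr has_density; apply/funext => y; rewrite /q0 mulr_suml; apply: eq_bigr => j _;
    rewrite mulrAC.
have d1 : has_density nu1 (fun y => q1 y / Z1).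
  have := has_density_mixture (fun j : 'I_q.+1 => divr_ge0 (ltW (W10 j)) (ltW Z10))
    (fun j : 'I_q.+1 => nd1 j) nu1E.
  by congr has_density; apply/funext => y; rewrite /q1 mulr_suml; apply: eq_bigr => j _;
    rewrite mulrAC.
pose A t := \sum_(j < q.+1) u j * expR (j%:R * t).
have q0E y : q0 y = normal_pdf 0 s y * A (a * (y / s)).
  rewrite /q0 /A mulr_sumr; apply: eq_bigr => j _.
  by rewrite /W0 -mulrA normal_pdf_tilt0// mulrCA; congr (_ * (_ * expR _)); ring.
have q1E y : q1 y = normal_pdf 0 s y *
    (expR (eta / 2 * (a * (y / s)) ^+ 2) * \sum_(j < q.+1) expR (j%:R * (a * (y / s)))).
  rewrite /q1 !mulr_sumr; apply: eq_bigr => j _.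
  rewrite /W1 -c2 normal_pdf_tilt1// c2; congr (_ * (expR _ * expR _)).
    by ring.
  by ring.
have diffE y : q1 y - q0 y = normal_pdf 0 s y * D (a * (y / s)).
  by rewrite q0E q1E -mulrBr.
have Age t : u ord0 <= A t.
  have := sum_ge (fun j => u j * expR (j%:R * t)); rewrite mul0r expR0 mulr1; apply.
  by move=> j; rewrite mulr_ge0 ?expR_ge0// ltW.
have pdf0 y := normal_pdf_gt0 0 y s0.
have q00 y : 0 < q0 y by rewrite q0E mulr_gt0// (lt_le_trans (u0 ord0)).
have mq0 : measurable_fun setT q0.
  apply: measurable_sum => j; apply: measurable_funM => //; exact: measurable_normal_pdf.
have mq1 : measurable_fun setT q1.
  apply: measurable_sum => j; apply: measurable_funM => //; exact: measurable_normal_pdf.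
pose X := C1 / u ord0 * a ^+ (q.+1 * 2).
have X0 : 0 <= X by rewrite mulr_ge0 ?exprn_ge0 ?divr_ge0 ?ltW.
have Xu : (\int[mu]_y ((q1 y - q0 y) ^+ 2 / q0 y)%:E <= X%:E)%E.
  apply: (@le_trans _ _ (\int[mu]_y (X * normal_pdf 0 (Num.sqrt 2 * s) y)%:E)%E).
    apply: ge0_le_integral => //.
    - by move=> y _; rewrite lee_fin divr_ge0 ?sqr_ge0// ltW.
    - apply/measurable_EFinP; apply: measurable_funM; last exact: measurable_inv.
      by apply: measurable_funX; exact: measurable_funB.
    - apply/measurable_EFinP; apply: measurable_funM => //; exact: measurable_normal_pdf.
    - move=> y _; rewrite lee_fin diffE q0E ler_pdivrMr; last by rewrite -q0E.
      have := hchi a s y; rewrite agt0 aa1 s0 => /(_ isT isT).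
      set p := normal_pdf 0 s y; set p' := normal_pdf 0 _ y => h.
      rewrite (_ : (p * _) ^+ 2 = p * (p * D (a * (y / s)) ^+ 2)); last by ring.
      rewrite [leRHS](_ : _ = p * (X * p' * A (a * (y / s)))); last by ring.
      rewrite ler_wpM2l ?(ltW (pdf0 y))//; apply: (le_trans h).
      have p'0 : 0 <= p' by exact: normal_pdf_ge0.
      rewrite /X [leRHS](_ : _ = C1 * a ^+ (q.+1 * 2) * p' * (A (a * (y / s)) / u ord0));
        last by ring.
      apply: ler_peMr; last by rewrite ler_pdivlMr ?mul1r.
      by apply: mulr_ge0 => //; apply: mulr_ge0; rewrite ?exprn_ge0// ltW.
  have mE : measurable_fun setT (fun y => (normal_pdf 0 (Num.sqrt 2 * s) y)%:E).
    by apply/measurable_EFinP; exact: measurable_normal_pdf.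
  have n0 y : setT y -> (0 <= (normal_pdf 0 (Num.sqrt 2 * s) y)%:E)%E.
    by rewrite lee_fin normal_pdf_ge0.
  have XE : (0 <= X%:E)%E by rewrite lee_fin.
  under eq_integral do rewrite EFinM.
  by rewrite (ge0_integralZl mu measurableT mE n0 XE) integral_normal_pdf mule1.
apply: square_dominatedW (chi_square_dominated Z00 Z10 X0 q00 d0 d1 mq0 mq1 Xu).
rewrite lerD2l -[leRHS]mulrA -/X ler_pdivrMr ?exprn_gt0//.
apply: (@le_trans _ _ (Zmax * X)); first by rewrite ler_wpM2r.
by apply: ler_peMr; [rewrite mulr_ge0// ltW|exact: exprn_ege1].
Qed.

End moment_matched_mixtures.

(** * Lower bounds *)

Section utilities.
Context {R : realType}.

Lemma bump_sum_center (p : {poly R}) N (c : nat -> R) (i : nat) : (i < N)%N ->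
  p.[0] = 0 -> p.[1] = 0 -> p.[1 / 2] = 1 -> bump_sum p N c (i%:R + 1 / 2) = c i.
Proof.
move=> iN p0 p1 ph; rewrite /bump_sum (bigD1 (Ordinal iN))//= big1 ?addr0.
  rewrite addrAC subrr add0r; case: clampP => h; rewrite ?ph ?mulr1//; lra.
move=> j; rewrite -val_eqE/= => ji.
have [ij|ij] := ltnP i j.
  have : i.+1%:R <= j%:R :> R by rewrite ler_nat.
  rewrite -natr1 => h; case: clampP => h'; rewrite ?p0 ?p1 ?mulr0//; lra.
have {}ji : (j < i)%N by rewrite ltn_neqAle ji.
have : j.+1%:R <= i%:R :> R by rewrite ler_nat.
by rewrite -natr1 => h; case: clampP => h'; rewrite ?p0 ?p1 ?mulr0//; lra.
Qed.

Lemma const_Lipschitz_class (b M v : R) : 0 < b -> `|v| <= M ->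
  Lipschitz_class b M (fun=> v).
Proof.
move=> b0 vM; have [p [L [_ _ _ _ h]]] := bump_Lipschitz_class b0.
have c0 (j : nat) : `|0 : R| <= 0 * 1 `^ (- b) by rewrite normr0 mul0r.
have vM0 : `|v| + 0 * L <= M by rewrite mul0r addr0.
have := h 0%N (fun=> 0) M 1 0 v 0 (lexx _) (lexx _) c0 vM0.
by congr Lipschitz_class; apply/funext => x; rewrite /bump_sum big_ord0 addr0.
Qed.

(** One bump of width 1/n per design point: the shift by 1/2 puts the centre of bump i at (i + 1) /
    n, so neighbouring values can be prescribed freely. *)
Lemma Lipschitz_interpolation (b : R) : 0 < b -> exists2 L : R, 0 < L &
  forall M n (g : 'I_n -> R) A, (0 < n)%N -> 0 <= A ->
    (forall i, `|g i| <= A * n%:R `^ (- b)) -> A * L <= M ->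
    exists2 f, Lipschitz_class b M f & forall i, f (design R i) = g i.
Proof.
move=> b0; have [p [L [L0 [p0 p1 ph] _ _ h]]] := bump_Lipschitz_class b0.
exists L => // M n g A n0 A0 gA AL.
pose c k := if insub k is Some i then g i else 0.
exists (fun x => 0 + bump_sum p n c (n%:R * x - 1 / 2)).
  apply: (h _ _ _ _ _ _ A) => //; first by rewrite ler1n.
    move=> j; rewrite /c; case: insubP => [i _ _|_]; first exact: gA.
    by rewrite normr0 mulr_ge0// powR_ge0.
  by rewrite normr0 add0r.
move=> i; have nn : n%:R != 0 :> R by rewrite pnatr_eq0 -lt0n.
rewrite add0r (_ : _ - _ = i%:R + 1 / 2).
  by rewrite bump_sum_center// /c valK.
by rewrite /design -natr1; field.
Qed.

(** The set injects into the integers between its least and greatest elements. It will count the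
    design points under one bump. *)
Lemma card_ord_interval (n : nat) (a l : R) : 0 <= l ->
  #|[set i : 'I_n | a < i%:R < a + l]%SET|%:R <= l + 1.
Proof.
move=> l0; set S := [set _ | _]%SET.
have [->|[i0 i0S]] := set_0Vmem S; first by rewrite cards0 addr_ge0.
have [i iS imin] := arg_minnP (val : 'I_n -> nat) i0S.
have [k kS kmax] := arg_maxnP (val : 'I_n -> nat) i0S.
have SI j : j \in S -> (i <= j <= k)%N by move=> jS; apply/andP; split; [exact: imin|exact: kmax].
pose f (j : 'I_n) : 'I_(k - i).+1 := inord (j - i).
have finj : {in S &, injective f}.
  move=> x y /SI/andP[ix xk] /SI/andP[iy yk] /(congr1 val).
  rewrite /= !inordK ?ltnS ?leq_sub2r// => e; apply: val_inj => /=.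
  by rewrite -(subnK ix) e subnK.
have cS : (#|S| <= (k - i).+1)%N.
  by rewrite -(card_in_imset finj) (leq_trans (max_card _))// card_ord.
have ik : (i <= k)%N by have /andP[] := SI _ kS.
apply: (@le_trans _ _ (k - i).+1%:R); first by rewrite ler_nat.
rewrite -natr1 natrB//.
have SP (j : 'I_n) : j \in S -> a < j%:R < a + l by rewrite inE.
by have /andP[? ?] := SP i iS; have /andP[? ?] := SP k kS; lra.
Qed.

Lemma sum_prod_weights (n : nat) (I : finType) (w : I -> R) : \sum_k w k = 1 ->
  \sum_(J : {ffun 'I_n -> I}) \prod_i w (J i) = 1.
Proof.
by move=> w1; rewrite -(bigA_distr_bigA (fun _ : 'I_n => w))/= big1.
Qed.

Local Notation prob := (probability (measurableTypeR R) R).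

(** Independent draws at the coordinates: the product of the mixed one-coordinate masses expands
    into a sum over all assignments J. *)
Lemma product_law_mixture (n : nat) (I : finType) (w : I -> R)
    (law : 'I_n -> I -> prob) (Q : {ffun 'I_n -> I} -> probability (n.-tuple (measurableTypeR R)) R)
    (nu : 'I_n -> prob) (m : probability (n.-tuple (measurableTypeR R)) R) :
  (forall J : {ffun 'I_n -> I}, product_law (fun i => law i (J i)) (Q J)) ->
  (forall i A, measurable A -> nu i A = (\sum_k (w k)%:E * law i k A)%E) ->
  (forall A, m A = (\sum_(J : {ffun 'I_n -> I}) (\prod_i w (J i))%:E * Q J A)%E) ->
  product_law nu m.
Proof.
move=> QE nuE mE B mB; rewrite mE.
pose v i k := fine (law i k (B i)).
have vE i k : law i k (B i) = (v i k)%:E by rewrite fineK// fin_num_measure.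
have -> : (\prod_i nu i (B i) = (\prod_i \sum_k w k * v i k)%:E)%E.
  rewrite -prodEFin; apply: eq_bigr => i _; rewrite nuE// -sumEFin.
  by apply: eq_bigr => k _; rewrite vE EFinM.
rewrite bigA_distr_bigA/= -sumEFin; apply: eq_bigr => J _.
rewrite QE// big_split/= EFinM; congr (_ * _)%E.
by rewrite -prodEFin; apply: eq_bigr => i _; rewrite vE.
Qed.

End utilities.

Section two_mixtures.
Context d (T : measurableType d) (R : realType) (P : probability T R).
Variables (n : nat) (z : 'I_n -> {RV P >-> R}).
Hypothesis iidz : iid_std_normal z.
Local Notation prob := (probability (measurableTypeR R) R).

Lemma ex_observation_mixture (I : finType) (w : I -> R) (m : 'I_n -> I -> R)
    (f : {ffun 'I_n -> I} -> R -> R) (V : R -> R) (nu : 'I_n -> prob) :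
  (forall k, 0 <= w k) -> \sum_k w k = 1 -> (forall i : 'I_n, 0 < V (design R i)) ->
  (forall J i, f J (design R i) = m i (J i)) ->
  (forall i A, measurable A -> nu i A =
    (\sum_k (w k)%:E * normal_prob (m i k) (Num.sqrt (V (design R i))) A)%E) ->
  exists Q : probability (n.-tuple (measurableTypeR R)) R, product_law nu Q /\
    forall u : n.-tuple (measurableTypeR R) -> \bar R,
      measurable_fun setT u -> (forall y, 0 <= u y)%E ->
      (\int[Q]_y u y = \sum_(J : {ffun 'I_n -> I}) (\prod_i w (J i))%:E *
        \int[P]_t u (observations z (f J) V t))%E.
Proof.
move=> w0 w1 V0 fm nuE.
pose Qs J := sval (cid (observation_law (f J) iidz V0)).
have QsE (J : {ffun 'I_n -> I}) : product_law (fun i => normal_prob (m i (J i)) (Num.sqrt (V (design R i)))) (Qs J) /\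
    forall u : n.-tuple (measurableTypeR R) -> \bar R,
      measurable_fun setT u -> (forall y, 0 <= u y)%E ->
      (\int[Qs J]_y u y = \int[P]_t u (observations z (f J) V t))%E.
  have [hQ hu] := svalP (cid (observation_law (f J) iidz V0)).
  split; last exact: hu.
  move=> B mB; apply: etrans (hQ B mB) _.
  by apply: eq_bigr => i _; rewrite fm.
have wJ0 (J : {ffun 'I_n -> I}) : 0 <= \prod_i w (J i) by apply: prodr_ge0.
have [Q [QA Qu]] := ex_mixture Qs wJ0 (sum_prod_weights n w1).
exists Q; split.
  exact: (product_law_mixture
    (law := fun i k => normal_prob (m i k) (Num.sqrt (V (design R i))) : prob)
    (fun J => (QsE J).1) nuE QA).
move=> u mu u0; rewrite Qu//; apply: eq_bigr => J _.
by rewrite (QsE J).2.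
Qed.

(** The tensorized pair [M0], [M1] agrees on boxes, hence everywhere, with the mixtures [Q0], [Q1]
    of observation laws, under which the integrals of the loss are average risks. *)
Lemma mixture_two_points (I : finType) (w0 w1 : I -> R) (m0 m1 : 'I_n -> I -> R)
    (f0 f1 : {ffun 'I_n -> I} -> R -> R) (V0 V1 : R -> R) (K : 'I_n -> R) :
  (forall k, 0 <= w0 k) -> \sum_k w0 k = 1 -> (forall k, 0 <= w1 k) -> \sum_k w1 k = 1 ->
  (forall i : 'I_n, 0 < V0 (design R i)) -> (forall i : 'I_n, 0 < V1 (design R i)) ->
  (forall J i, f0 J (design R i) = m0 i (J i)) ->
  (forall J i, f1 J (design R i) = m1 i (J i)) ->
  (forall i, 1 <= K i) ->
  (forall i (nu0 nu1 : prob),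
    (forall A, measurable A -> nu0 A =
      (\sum_k (w0 k)%:E * normal_prob (m0 i k) (Num.sqrt (V0 (design R i))) A)%E) ->
    (forall A, measurable A -> nu1 A =
      (\sum_k (w1 k)%:E * normal_prob (m1 i k) (Num.sqrt (V1 (design R i))) A)%E) ->
    square_dominated (K i) nu0 nu1) ->
  forall Vhat x, @estimators R n Vhat -> x \in `[0, 1] ->
  (((V0 x - V1 x) ^+ 2 / (8 * \prod_i K i))%:E <=
    \sum_(J : {ffun 'I_n -> I}) (\prod_i w0 (J i))%:E * pointwise_risk z x Vhat (f0 J) V0 +
    \sum_(J : {ffun 'I_n -> I}) (\prod_i w1 (J i))%:E * pointwise_risk z x Vhat (f1 J) V1)%E.
Proof.
move=> w00 w01 w10 w11 V00 V10 f0E f1E K1 dom Vhat x mVhat x01.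
have ex_nu (w : I -> R) (m : 'I_n -> I -> R) (V : R -> R) :
    (forall k, 0 <= w k) -> \sum_k w k = 1 ->
    exists nu : 'I_n -> prob, forall i A, measurable A -> nu i A =
      (\sum_k (w k)%:E * normal_prob (m i k) (Num.sqrt (V (design R i))) A)%E.
  move=> w0' w1'.
  have h i := ex_mixture (fun k => normal_prob (m i k) (Num.sqrt (V (design R i))) : prob) w0' w1'.
  exists (fun i => sval (cid (h i))) => i A mA.
  by case: cid => nu /= [+ _]; exact.
have [nu0 nu0E] := ex_nu w0 m0 V0 w00 w01.
have [nu1 nu1E] := ex_nu w1 m1 V1 w10 w11.
have [Q0 [Q0law Q0u]] := ex_observation_mixture w00 w01 V00 f0E nu0E.
have [Q1 [Q1law Q1u]] := ex_observation_mixture w10 w11 V10 f1E nu1E.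
have K0 i : 0 < K i by exact: lt_le_trans (K1 i).
have [M0 [M1 [M0law M1law hM]]] := product_square_dominated K0
  (fun i => dom i (nu0 i) (nu1 i) (nu0E i) (nu1E i)).
have law_eq (nu : 'I_n -> prob) (Q M : probability (n.-tuple (measurableTypeR R)) R) :
    product_law nu Q -> product_law nu M -> forall A, measurable A -> Q A = M A.
  move=> hQ hM'; apply: product_law_unique; first exact: le_lt_trans (probability_le1 Q measurableT) (ltry 1).
  by move=> B mB; exact: etrans (hQ B mB) (esym (hM' B mB)).
have hQ A : measurable A -> ((Q1 A) ^+ 2 <= (\prod_i K i)%:E * Q0 A)%E.
  by move=> mA; rewrite (law_eq _ _ _ Q1law M1law)// (law_eq _ _ _ Q0law M0law)//; exact: hM.
have PK1 : 1 <= \prod_i K i.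
  elim/big_ind : _ => // a b a1 b1; rewrite -[leLHS]mulr1 ler_pM//.
have mt := measurable_estimator mVhat x01.
have := le_cam_two_points (V0 x) (V1 x) PK1 hQ mt.
have mloss v : measurable_fun setT
    (fun y : n.-tuple (measurableTypeR R) => ((Vhat y x - v) ^+ 2)%:E).
  by apply/measurable_EFinP; apply: measurable_funX; exact: measurable_funB.
have loss0 v (y : n.-tuple (measurableTypeR R)) : (0 <= ((Vhat y x - v) ^+ 2)%:E)%E.
  by rewrite lee_fin sqr_ge0.
by rewrite Q0u// Q1u.
Qed.

End two_mixtures.

(** * The rate n^(-4 alpha): random mean, constant variance *)

Section mean_lower_bound.
Context {R : realType}.

Lemma prodr_le_expR n (K : 'I_n -> R) (C : R) : (forall i, 0 <= K i) ->
  \sum_i K i <= C -> \prod_i (1 + K i) <= expR C.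
Proof.
move=> K0 KC; apply: (@le_trans _ _ (expR (\sum_i K i))); last by rewrite ler_expR.
rewrite expR_sum; apply: ler_prod => i _.
by rewrite addr_ge0//= expR_ge1Dx.
Qed.

Lemma mean_lower_bound (alpha beta Mf MV : R) : 0 < alpha <= 1 -> 0 < beta ->
  0 < Mf -> 0 < MV ->
  exists2 C : R, 0 < C &
    forall (d : measure_display) (T : measurableType d) (P : probability T R)
      (n : nat) (z : 'I_n -> {RV P >-> R}), (0 < n)%N -> iid_std_normal z ->
    ((C * n%:R `^ (- (4 * alpha)))%:E <=
       minimax (parameters alpha beta Mf MV) (global_risk z))%E /\
    forall xs : R, 0 < xs < 1 ->
      ((C * n%:R `^ (- (4 * alpha)))%:E <=
         minimax (parameters alpha beta Mf MV) (pointwise_risk z xs))%E.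
Proof.
move=> /andP[alpha0 alpha1] beta0 Mf0 MV0.
pose q := Num.truncn alpha^-1.
have aq : 1 <= q.+1%:R * alpha.
  by rewrite -ler_pdivrMr// mul1r ltW// truncnS_gt.
have [L L0 interp] := Lipschitz_interpolation alpha0.
have [eta [a0 [C [eta0 a00 C0 mix]]]] := @mixture_square_dominated R q.
(* Half of MV, so that the larger variance s^2 / b, with b >= 1/2, does not exceed MV. *)
pose s := Num.sqrt (MV / 2).
have s0 : 0 < s by rewrite sqrtr_gt0 divr_gt0.
have s2 : s ^+ 2 = MV / 2 by rewrite sqr_sqrtr// ltW// divr_gt0.
have q0 : 0 < q.+1%:R :> R by rewrite ltr0n.
(* The second bound puts the interpolated means in the class; its factor 2 covers the means divided
   by b >= 1/2. *)
pose kap := Num.min a0 (Mf / (2 * s * q.+1%:R * L)).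
have D0 : 0 < 2 * s * q.+1%:R * L by rewrite !mulr_gt0.
have kap0 : 0 < kap by rewrite lt_min a00 divr_gt0.
have [kapa kapM] : kap <= a0 /\ kap <= Mf / (2 * s * q.+1%:R * L).
  by rewrite /kap !ge_min !lexx orbT.
pose Kmax := expR (C * kap ^+ (q.+1 * 2)).
exists ((s ^+ 2 * eta * kap ^+ 2) ^+ 2 / (16 * Kmax)).
  by rewrite divr_gt0 ?mulr_gt0 ?exprn_gt0 ?expR_gt0// !mulr_gt0 ?exprn_gt0.
move=> d T P n z n0 iidz.
have n1 : 1 <= n%:R :> R by rewrite ler1n.
have nr0 : 0 < n%:R :> R by rewrite ltr0n.
have nne : n%:R == 0 :> R = false by rewrite gt_eqF.
pose na : R := n%:R `^ (- alpha).
have na0 : 0 < na by rewrite powR_gt0.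
have na1 : na <= 1 by rewrite /na -[leRHS](powRr0 n%:R) ler_powR// oppr_le0 ltW.
pose a := kap * na.
have agt0 : 0 < a by rewrite mulr_gt0.
have aa0 : 0 < a <= a0.
  by rewrite agt0 (le_trans _ kapa)// ler_piMr// ltW.
have [etaa [w0 [w1 [[w00 w01] [w10 w11] dom]]]] := mix a s aa0 s0.
set b := 1 - eta * a ^+ 2 in dom.
have b2 : 1 / 2 <= b by clear -etaa; rewrite /b; lra.
have b0 : 0 < b by exact: lt_le_trans b2.
have be0 : 0 <= eta * a ^+ 2 by rewrite mulr_ge0 ?sqr_ge0// ltW.
pose A := 2 * s * kap * q.+1%:R.
have A0 : 0 <= A by rewrite !mulr_ge0// ltW.
have AL : A * L <= Mf.
  rewrite (_ : A * L = kap * (2 * s * q.+1%:R * L)); last by rewrite /A; ring.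
  by rewrite -ler_pdivlMr.
have bnd (k : 'I_q.+1) : 0 <= s * (a * k%:R) /\ 2 * (s * (a * k%:R)) <= A * na.
  have k0 : 0 <= k%:R :> R by [].
  split; first by rewrite !mulr_ge0// ltW.
  rewrite (_ : A * na = 2 * (s * (a * q.+1%:R))); last by rewrite /A /a; ring.
  by rewrite ler_pM2l// ler_pM2l// ler_pM2l// ler_nat ltnW.
have ex_f (m : 'I_q.+1 -> R) : (forall k, `|m k| <= A * na) ->
    exists f : {ffun 'I_n -> 'I_q.+1} -> R -> R, forall J,
      Lipschitz_class alpha Mf (f J) /\ forall i, f J (design R i) = m (J i).
  move=> hm; have h J := interp Mf n (fun i => m (J i)) A n0 A0 (fun i => hm (J i)) AL.
  exists (fun J : {ffun 'I_n -> 'I_q.+1} => sval (cid2 (h J))) => J.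
  by case: cid2.
pose m0 (k : 'I_q.+1) := s * (a * k%:R).
pose m1 (k : 'I_q.+1) := s * (a * k%:R) / b.
have [f0 f0P] : exists f : {ffun 'I_n -> 'I_q.+1} -> R -> R, forall J,
      Lipschitz_class alpha Mf (f J) /\ forall i, f J (design R i) = m0 (J i).
  by apply: ex_f => k; have [h1 h2] := bnd k; rewrite /m0 ger0_norm//; clear -h1 h2; lra.
have [f1 f1P] : exists f : {ffun 'I_n -> 'I_q.+1} -> R -> R, forall J,
      Lipschitz_class alpha Mf (f J) /\ forall i, f J (design R i) = m1 (J i).
  apply: ex_f => k; have [h1 h2] := bnd k.
  rewrite /m1 ger0_norm ?divr_ge0 ?(ltW b0)// ler_pdivrMr//.
  have : (A * na) * (1 / 2) <= (A * na) * b by rewrite ler_wpM2l// mulr_ge0// ltW.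
  by lra.
pose v (c : bool) := if c then s ^+ 2 / b else s ^+ 2.
have v0 c : 0 < v c by rewrite /v; case: c; rewrite ?divr_gt0 ?exprn_gt0.
have vM c : `|v c| <= MV.
  rewrite gtr0_norm// /v; case: c; last by rewrite s2; clear -MV0; lra.
  rewrite ler_pdivrMr// s2; have h := ler_wpM2l (ltW MV0) b2; clear -h; lra.
have sv0 : Num.sqrt (v false) = s by rewrite /v sqrtr_sqr gtr0_norm.
have sv1 : Num.sqrt (v true) = s / Num.sqrt b.
  by rewrite /v sqrtrM ?sqr_ge0// sqrtr_sqr gtr0_norm// sqrtrV// ltW.
pose K := 1 + C * a ^+ (q.+1 * 2).
have Ca0 : 0 <= C * a ^+ (q.+1 * 2) by rewrite mulr_ge0 ?exprn_ge0 ?ltW.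
(* The exponent 1 - 2 alpha (q + 1) is negative by [aq]; hence the n factors K multiply to at most
   [Kmax]. *)
have nan : na ^+ (q.+1 * 2) * n%:R <= 1.
  rewrite /na -powR_mulrn ?powR_ge0// -powRrM -[n%:R in X in _ * X](powRr1 (ltW nr0)).
  rewrite -powRD ?nne ?implybT// -[leRHS](powRr0 n%:R) ler_powR//.
  by clear -aq; rewrite natrM; lra.
have prodK : \prod_(i < n) K <= Kmax.
  apply: prodr_le_expR => //; rewrite sumr_const card_ord -mulr_natr /a exprMn.
  rewrite (_ : _ * _ = C * kap ^+ (q.+1 * 2) * (na ^+ (q.+1 * 2) * n%:R)); last by ring.
  by rewrite ler_piMr// mulr_ge0 ?exprn_ge0 ?ltW.
(* The prior: a fair coin picks the hypothesis, then the means at the design points are drawn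
   independently. The coin turns the 8 of the two-point bound into 16. *)
have w0i : forall p : bool * {ffun 'I_n -> 'I_q.+1},
    0 <= 1 / 2 * \prod_i (if p.1 then w1 else w0) (p.2 i).
  by move=> [c J]; rewrite mulr_ge0// prodr_ge0// => i _; case: c.
have wsum : \sum_(p : bool * {ffun 'I_n -> 'I_q.+1})
    1 / 2 * \prod_i (if p.1 then w1 else w0) (p.2 i) = 1.
  rewrite -(pair_bigA _ (fun c (J : {ffun 'I_n -> 'I_q.+1}) =>
     1 / 2 * \prod_i (if c then w1 else w0) (J i)))/=.
  by rewrite big_bool/= -!mulr_sumr !sum_prod_weights//; field.
pose F (p : bool * {ffun 'I_n -> 'I_q.+1}) := if p.1 then f1 p.2 else f0 p.2.
pose V (p : bool * {ffun 'I_n -> 'I_q.+1}) : R -> R := fun=> v p.1.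
have inTheta p : parameters alpha beta Mf MV (F p, V p).
  split=> /=; first by rewrite /F; case: p.1; [exact: (f1P _).1|exact: (f0P _).1].
    exact: const_Lipschitz_class.
  by move=> x _; exact: (ltW (v0 p.1)).
pose rate : R := (s ^+ 2 * eta * kap ^+ 2) ^+ 2 / (16 * Kmax) * n%:R `^ (- (4 * alpha)).
have rateE : rate = (s ^+ 2 * eta * a ^+ 2) ^+ 2 / (16 * Kmax).
  rewrite /rate /a.
  have -> : n%:R `^ (- (4 * alpha)) = na ^+ 4.
    by rewrite /na -powR_mulrn ?powR_ge0// -powRrM; congr (_ `^ _); ring.
  by field; rewrite gt_eqF ?expR_gt0.
have rate0 : 0 <= rate by rewrite mulr_ge0 ?powR_ge0// divr_ge0 ?sqr_ge0// mulr_ge0 ?expR_ge0.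
have key Vhat : @estimators R n Vhat -> forall x, x \in `[0, 1] ->
    (rate%:E <= \sum_(p : bool * {ffun 'I_n -> 'I_q.+1}) (1 / 2 * \prod_i (if p.1 then w1 else w0) (p.2 i))%:E *
       pointwise_risk z x Vhat (F p) (V p))%E.
  move=> mVhat x x01.
  have := @mixture_two_points _ _ _ _ _ _ iidz _ w0 w1 (fun=> m0) (fun=> m1) f0 f1
    (fun=> v false) (fun=> v true) (fun=> K) w00 w01 w10 w11 (fun=> v0 false)
    (fun=> v0 true) (fun J i => (f0P J).2 i) (fun J i => (f1P J).2 i).
  rewrite lerDl => /(_ (fun=> Ca0)); rewrite sv0 sv1 => /(_ (fun _ => dom)).
  move=> /(_ _ _ mVhat x01) h.
  apply: (@le_trans _ _ ((1 / 2)%:E *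
    ((v false - v true) ^+ 2 / (8 * \prod_(i < n) K))%:E)%E).
    rewrite -EFinM lee_fin rateE.
    have PK0 : 0 < \prod_(i < n) K by apply: prodr_gt0 => i _; rewrite ltr_wpDr.
    have -> : v false - v true = - (s ^+ 2 * (eta * a ^+ 2) / b).
      by rewrite /v /b; field; rewrite -/b gt_eqF.
    rewrite sqrrN.
    have sea0 : 0 <= s ^+ 2 * eta * a ^+ 2 by rewrite -mulrA mulr_ge0 ?sqr_ge0.
    have h1 : (s ^+ 2 * eta * a ^+ 2) ^+ 2 <= (s ^+ 2 * (eta * a ^+ 2) / b) ^+ 2.
      rewrite [s ^+ 2 * (eta * _)]mulrA; move: sea0; move: (s ^+ 2 * eta * a ^+ 2) => y y0.
      have yb : y <= y / b by rewrite ler_pdivlMr// ler_piMr// /b lerBlDr lerDl.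
      by rewrite lerXn2r// nnegrE// (le_trans y0).
    rewrite (_ : 1 / 2 * (_ / _) = (s ^+ 2 * (eta * a ^+ 2) / b) ^+ 2 / (16 * \prod_(i < n) K));
      last by field; rewrite !gt_eqF.
    apply: ler_pM => //; rewrite ?sqr_ge0 ?invr_ge0 ?mulr_ge0 ?expR_ge0//.
    by rewrite lef_pV2 ?posrE ?mulr_gt0 ?expR_gt0// ler_pM2l.
  apply: (le_trans (lee_wpmul2l _ h)); first by rewrite lee_fin.
  rewrite -(pair_bigA _ (fun c (J : {ffun 'I_n -> 'I_q.+1}) =>
     (1 / 2 * \prod_i (if c then w1 else w0) (J i))%:E *
       pointwise_risk z x Vhat (F (c, J)) (V (c, J)))%E)/=.
  rewrite big_bool/= addeC.
  have pr0 f g : (0 <= pointwise_risk z x Vhat f g)%E.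
    by apply: integral_ge0 => t _; rewrite lee_fin sqr_ge0.
  rewrite ge0_muleDr; last 2 first.
  - by apply: sume_ge0 => J _; rewrite mule_ge0// lee_fin prodr_ge0.
  - by apply: sume_ge0 => J _; rewrite mule_ge0// lee_fin prodr_ge0.
  rewrite !ge0_sume_distrr; last 2 first.
  - by move=> J _; rewrite mule_ge0// lee_fin prodr_ge0.
  - by move=> J _; rewrite mule_ge0// lee_fin prodr_ge0.
  by apply: leeD; apply: lee_sum => J _; rewrite muleA -EFinM.
split.
  have mV p : measurable_fun setT (V p) by exact: measurable_cst.
  have ml : measurable_fun (`[0%R, 1%R]%classic : set (measurableTypeR R)) (cst rate).
    exact: measurable_cst.
  have <- : (\int[@lebesgue_measure R]_(x in `[0%R, 1%R]) cst rate%:E x = rate%:E)%E.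
    by rewrite integral_cst//= lebesgue_measure_itv/= lte_fin ltr01 oppr0 adde0 mule1.
  exact: (global_minimax_ge w0i wsum inTheta mV ml (fun=> rate0) key).
move=> xs /andP[xs0 xs1]; apply: (pointwise_minimax_ge w0i wsum inTheta) => Vhat mVhat.
by apply: key => //; rewrite in_itv/= !ltW.
Qed.

End mean_lower_bound.

(** * The rate n^(-2 beta / (1 + 2 beta)): bumps switched by bits *)

Section hypercube.
Context {R : realType}.

Definition flip N (j : 'I_N) (o : {ffun 'I_N -> bool}) : {ffun 'I_N -> bool} :=
  [ffun k => if k == j then ~~ o k else o k].

Lemma flipK N (j : 'I_N) : involutive (flip j).
Proof. by move=> o; apply/ffunP => k; rewrite !ffunE; case: eqP => // _; rewrite negbK. Qed.

Lemma hypercube_weights N : \sum_(o : {ffun 'I_N -> bool}) 2^-1 ^+ N = 1 :> R.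
Proof.
rewrite sumr_const card_ffun card_bool card_ord -[LHS]mulr_natr natrX -exprMn.
by rewrite mulVf// expr1n.
Qed.

(** Flipping bit j permutes the cube, so r and its flipped version have the same average; adding the
    two gives D <= 2 S. *)
Lemma flip_average N (j : 'I_N) (r : {ffun 'I_N -> bool} -> \bar R) (D : R) :
  (forall o, 0 <= r o)%E -> (forall o, (D%:E <= r o + r (flip j o))%E) ->
  ((D / 2)%:E <= \sum_o (2^-1 ^+ N)%:E * r o)%E.
Proof.
move=> r0 hD; have w0 : (0 <= (2^-1 ^+ N)%:E :> \bar R)%E by rewrite lee_fin exprn_ge0.
set S := (\sum_o _)%E.
have S0 : (0 <= S)%E by apply: sume_ge0 => o _; rewrite mule_ge0.
have SE : S = (\sum_o (2^-1 ^+ N)%:E * r (flip j o))%E.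
  by rewrite /S (reindex_inj (inv_inj (@flipK _ j))).
have : (D%:E <= S + S)%E.
  rewrite {2}SE /S -big_split/=.
  apply: (@le_trans _ _ (\sum_(o : {ffun 'I_N -> bool}) (2^-1 ^+ N)%:E * D%:E)%E).
    rewrite -ge0_sume_distrl//.
    by rewrite sumEFin hypercube_weights mul1e.
  by apply: lee_sum => o _; rewrite -ge0_muleDr//; apply: lee_wpmul2l.
case: S S0 {SE} => [x| |]//; last by move=> *; rewrite leey.
by rewrite -EFinD !lee_fin => _ h; lra.
Qed.

End hypercube.

Section variance_two_points.
Context {R : realType}.
Local Notation prob := (probability (measurableTypeR R) R).

Lemma eq_square_dominated (K : R) (nu0 nu1 nu0' nu1' : prob) :
  (forall A, measurable A -> nu0 A = nu0' A) ->
  (forall A, measurable A -> nu1 A = nu1' A) ->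
  square_dominated K nu0' nu1' -> square_dominated K nu0 nu1.
Proof.
move=> e0 e1 h g mg g01.
have -> : (\int[nu1]_x (g x)%:E = \int[nu1']_x (g x)%:E)%E.
  by apply: eq_measure_integral => A mA _; exact: e1.
have -> : (\int[nu0]_x ((g x) ^+ 2)%:E = \int[nu0']_x ((g x) ^+ 2)%:E)%E.
  by apply: eq_measure_integral => A mA _; exact: e0.
exact: h.
Qed.

(** With index type [unit] the mixtures reduce to single normal laws; the product of the factors 1 +
    (V1 / V0 - 1)^2 is at most the exponential of the sum. *)
Lemma variance_two_points d (T : measurableType d) (P : probability T R) n
    (z : 'I_n -> {RV P >-> R}) (V0 V1 : R -> R) (C : R) : iid_std_normal z ->
  (forall i : 'I_n, 0 < V0 (design R i)) -> (forall i : 'I_n, 0 < V1 (design R i)) ->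
  (forall i : 'I_n, (V1 (design R i) / V0 (design R i) - 1) ^+ 2 <= 1 / 2) ->
  \sum_(i < n) (V1 (design R i) / V0 (design R i) - 1) ^+ 2 <= C ->
  forall Vhat x, @estimators R n Vhat -> x \in `[0, 1] ->
  (((V0 x - V1 x) ^+ 2 / (8 * expR C))%:E <=
    pointwise_risk z x Vhat (fun=> 0%R) V0 + pointwise_risk z x Vhat (fun=> 0%R) V1)%E.
Proof.
move=> iidz V00 V10 r2 rC Vhat x mVhat x01.
pose K (i : 'I_n) : R := 1 + (V1 (design R i) / V0 (design R i) - 1) ^+ 2.
pose w (_ : unit) : R := 1.
have w0 k : 0 <= w k by [].
have w1 : \sum_k w k = 1 by rewrite /w sumr_const card_unit.
have K1 i : 1 <= K i by rewrite lerDl sqr_ge0.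
have unit_mix (V : R -> R) (i : 'I_n) (nu : prob) :
    (forall A, measurable A -> nu A =
      (\sum_k (w k)%:E * normal_prob 0%R (Num.sqrt (V (design R i))) A)%E) ->
    forall A, measurable A -> nu A = normal_prob 0 (Num.sqrt (V (design R i))) A.
  move=> nuE A mA; rewrite nuE// /w; under eq_bigr do rewrite mul1e.
  by rewrite (eq_bigr (fun=> normal_prob 0 (Num.sqrt (V (design R i))) A))//
    big_const card_unit/= adde0.
have dom i (nu0 nu1 : prob) :
    (forall A, measurable A -> nu0 A =
      (\sum_k (w k)%:E * normal_prob 0%R (Num.sqrt (V0 (design R i))) A)%E) ->
    (forall A, measurable A -> nu1 A =
      (\sum_k (w k)%:E * normal_prob 0%R (Num.sqrt (V1 (design R i))) A)%E) ->
    square_dominated (K i) nu0 nu1.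
  move=> nu0E nu1E.
  have := @normal_square_dominated R (Num.sqrt (V0 (design R i))) (Num.sqrt (V1 (design R i))).
  rewrite !sqrtr_gt0 !sqr_sqrtr ?(ltW (V00 i)) ?(ltW (V10 i))// => h.
  exact: eq_square_dominated (unit_mix _ _ _ nu0E) (unit_mix _ _ _ nu1E)
    (h (V00 i) (V10 i) (r2 i)).
have := @mixture_two_points _ _ _ _ _ _ iidz _ w w (fun _ _ => 0) (fun _ _ => 0)
  (fun _ _ => 0) (fun _ _ => 0) V0 V1 K w0 w1 w0 w1 V00 V10
  (fun _ _ => erefl) (fun _ _ => erefl) K1 dom Vhat x mVhat x01.
have pr0 V : (0 <= pointwise_risk z x Vhat (fun=> 0%R) V)%E.
  by apply: integral_ge0 => t _; rewrite lee_fin sqr_ge0.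
have collapse c : (0 <= c)%E ->
    (\sum_(J : {ffun 'I_n -> unit}) (\prod_i w (J i))%:E * c = c)%E.
  move=> c0; rewrite -ge0_sume_distrl; last by move=> J _; rewrite lee_fin prodr_ge0.
  by rewrite sumEFin sum_prod_weights// mul1e.
rewrite !collapse//; apply: le_trans; rewrite lee_fin ler_wpM2l ?sqr_ge0//.
rewrite lef_pV2 ?posrE ?mulr_gt0 ?expR_gt0//; last first.
  by apply: prodr_gt0 => i _; exact: lt_le_trans (K1 i).
by rewrite ler_pM2l//; apply: prodr_le_expR => // i; exact: sqr_ge0.
Qed.

End variance_two_points.

Section bump_family.
Context {R : realType}.

Definition bits N (D : R) (o : {ffun 'I_N -> bool}) (k : nat) : R :=
  if insub k is Some j then (if o j then D else 0) else 0.

Lemma bits_bound N D (o : {ffun 'I_N -> bool}) k : 0 <= D -> `|bits D o k| <= D.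
Proof.
move=> D0; rewrite /bits; case: insubP => [j _ _|_]; last by rewrite normr0.
by case: (o j); rewrite ?normr0// ger0_norm.
Qed.

Lemma bump_sum_flip (p : {poly R}) N D (o : {ffun 'I_N -> bool}) (j : 'I_N) u :
  (bump_sum p N (bits D o) u - bump_sum p N (bits D (flip j o)) u) ^+ 2 =
  D ^+ 2 * p.[clamp (u - j%:R)] ^+ 2.
Proof.
rewrite /bump_sum -sumrB (bigD1 j)//= big1 ?addr0; last first.
  move=> k kj; rewrite /bits valK ffunE (negbTE kj); exact: subrr.
rewrite /bits valK ffunE eqxx; case: (o j) => /=.
  by rewrite mul0r subr0 exprMn.
by rewrite mul0r sub0r sqrrN exprMn.
Qed.

End bump_family.

Section flip_risk.
Context {R : realType}.

(** A flip changes V only under bump j, by a relative amount at most m^-b / 3, because D L = m^-b MV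
    / 8 and V >= 3 MV / 8. At most n / m + 1 design points lie there, so n <= m^(1 + 2 b) bounds the
    sum of squares by 1, whence the factor e. *)
Lemma flip_risk (b : R) (p : {poly R}) (L MV : R) : 0 < b -> 0 < L -> 0 < MV ->
  p.[0] = 0 -> p.[1] = 0 ->
  (forall x y, 0 <= x <= 1 -> 0 <= y <= 1 -> `|p.[y] - p.[x]| <= L * `|y - x|) ->
  (forall N c (A : R), (forall j, `|c j| <= A) ->
      forall u, `|bump_sum p N c u| <= A * L) ->
  forall d (T : measurableType d) (P : probability T R) n (z : 'I_n -> {RV P >-> R})
    (N : nat) (m s : R), (0 < n)%N -> iid_std_normal z -> 1 <= m ->
  n%:R <= m `^ (1 + 2 * b) ->
  let D := MV / (8 * L) * m `^ (- b) in
  let V := fun (o : {ffun 'I_N -> bool}) x => MV / 2 + bump_sum p N (bits D o) (m * x - s) in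
  forall Vhat x (j : 'I_N), @estimators R n Vhat -> x \in `[0, 1] ->
  ((D ^+ 2 * p.[clamp (m * x - s - j%:R)] ^+ 2 / (16 * expR 1))%:E <=
    \sum_o (2^-1 ^+ N)%:E * pointwise_risk z x Vhat (fun=> 0%R) (V o))%E.
Proof.
move=> b0 L0 MV0 p0 p1 pL bL d T P n z N m s n0 iidz m1 nm D V Vhat x j mVhat x01.
have mgt0 : 0 < m by lra.
have mne : m == 0 = false by rewrite gt_eqF.
have mb1 : m `^ (- b) <= 1 by rewrite -[leRHS](powRr0 m) ler_powR// oppr_le0 ltW.
have mb0 : 0 < m `^ (- b) by rewrite powR_gt0.
have D0 : 0 < D by rewrite mulr_gt0// divr_gt0// mulr_gt0.
have DL : D * L = MV / 8 * m `^ (- b) by rewrite /D; field; rewrite gt_eqF.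
have DL8 : D * L <= MV / 8 by rewrite DL ler_piMr// divr_ge0// ltW.
have Vb o y : 3 / 8 * MV <= V o y.
  have := bL N (bits D o) D (fun k => bits_bound o k (ltW D0)) (m * y - s).
  by rewrite /V ler_norml => /andP[h1 h2]; lra.
have V0 o y : 0 < V o y by apply: lt_le_trans (Vb o y); rewrite mulr_gt0.
have pb u : `|p.[clamp u]| <= L.
  have := pL 0 (clamp u); rewrite lexx ler01 clamp_itv p0 !subr0 => /(_ isT isT).
  move/le_trans; apply; rewrite ler_piMr ?(ltW L0)//.
  by have /andP[h1 h2] := clamp_itv u; rewrite ger0_norm.
pose chi o y := (V (flip j o) y / V o y - 1) ^+ 2.
have chi_le o y : chi o y <= if 0 < m * y - s - j%:R < 1 then (m `^ (- b) / 3) ^+ 2 else 0.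
  have -> : chi o y = (V o y - V (flip j o) y) ^+ 2 / V o y ^+ 2.
    by rewrite /chi; field; rewrite gt_eqF.
  have -> : V o y - V (flip j o) y = bump_sum p N (bits D o) (m * y - s) -
      bump_sum p N (bits D (flip j o)) (m * y - s) by rewrite /V; ring.
  rewrite bump_sum_flip; case: ifPn => h.
    rewrite -exprMn -expr_div_n -[leLHS]real_normK ?num_real//.
    rewrite lerXn2r ?nnegrE ?divr_ge0 ?(ltW mb0)// normrM normfV (gtr0_norm (V0 _ _)).
    rewrite ler_pdivrMr// normrM (gtr0_norm D0).
    apply: (@le_trans _ _ (D * L)); first by apply: ler_wpM2l (pb _); exact: ltW.
    rewrite DL; have := ler_wpM2l (ltW mb0) (Vb o y); lra.
  suff -> : p.[clamp (m * y - s - j%:R)] = 0 by rewrite expr0n/= mulr0 mul0r.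
  case: clampP h => // /andP[]; move: (_ - j%:R) => u u0 u1.
  rewrite !lt_neqAle u0 u1 !andbT negb_and !negbK => /orP[/eqP <-|/eqP ->] //.
have c1 : (m `^ (- b) / 3) ^+ 2 <= 1 / 9.
  rewrite expr_div_n (_ : 3 ^+ 2 = 9); last by ring.
  by rewrite ler_wpM2r// expr_le1// ltW.
have chi2 o y : chi o y <= 1 / 2.
  by apply: (le_trans (chi_le o y)); case: ifP => _ //=; lra.
have sum_chi o : \sum_(i < n) chi o (design R i) <= 1.
  apply: (le_trans (ler_sum _ (fun i _ => chi_le o (design R i)))).
  rewrite [leLHS](_ : _ = (m `^ (- b) / 3) ^+ 2 *
      #|[pred i : 'I_n | 0 < m * design R i - s - j%:R < 1]|%:R); last first.
    by rewrite mulr_natr -sumr_const [RHS]big_mkcond; apply: eq_bigr => i _.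
  have nr0 : 0 < n%:R :> R by rewrite ltr0n.
  (* The -1 accounts for design point i being (i + 1) / n. *)
  pose a := (s + j%:R) * n%:R / m - 1.
  have := @card_ord_interval R n a (n%:R / m); rewrite divr_ge0 ?(ltW nr0) ?(ltW mgt0)//.
  move=> /(_ isT).
  have -> : #|[set i : 'I_n | a < i%:R < a + n%:R / m]%SET| =
      #|[pred i : 'I_n | 0 < m * design R i - s - j%:R < 1]|.
    apply: eq_card => i; rewrite !inE; have -> : a < i%:R = (0 < m * design R i - s - j%:R).
      rewrite /a ltrBlDr natr1 ltr_pdivrMr// -subr_gt0 /design.
      rewrite (_ : m * _ - s - j%:R = (i.+1%:R * m - (s + j%:R) * n%:R) / n%:R).
        by rewrite pmulr_lgt0// invr_gt0.
      by field; rewrite gt_eqF.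
    have -> : i%:R < a + n%:R / m = (m * design R i - s - j%:R < 1).
      rewrite /a addrAC ltrBrDr natr1 -mulrDl ltr_pdivlMr// -subr_lt0 /design.
      rewrite -[RHS]subr_lt0.
      rewrite (_ : m * _ - s - j%:R - 1 = (i.+1%:R * m - ((s + j%:R) * n%:R + n%:R)) / n%:R).
        by rewrite pmulr_llt0// invr_gt0.
      by field; rewrite gt_eqF.
    by [].
  move=> hk; apply: (le_trans (ler_wpM2l (sqr_ge0 _) hk)).
  have h1 : (m `^ (- b)) ^+ 2 * (n%:R / m) <= 1.
    rewrite mulrA ler_pdivrMr// mul1r.
    apply: (@le_trans _ _ ((m `^ (- b)) ^+ 2 * m `^ (1 + 2 * b))).
      by rewrite ler_wpM2l// sqr_ge0.
    rewrite -powR_mulrn ?powR_ge0// -powRrM -powRD ?mne ?implybT//.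
    have -> : - b * 2 + (1 + 2 * b) = 1 by ring.
    by rewrite powRr1// ltW.
  have h2 : (m `^ (- b)) ^+ 2 <= 1 by rewrite expr_le1// ltW.
  rewrite [leLHS](_ : _ = ((m `^ (- b)) ^+ 2 * (n%:R / m) + (m `^ (- b)) ^+ 2) / 9).
    by lra.
  by field; rewrite mne.
have h o := @variance_two_points _ _ _ _ _ z (V o) (V (flip j o)) 1 iidz
  (fun i => V0 o _) (fun i => V0 (flip j o) _) (fun i => chi2 o _) (sum_chi o) Vhat x mVhat x01.
have pr0 f g : (0 <= pointwise_risk z x Vhat f g)%E.
  by apply: integral_ge0 => t _; rewrite lee_fin sqr_ge0.
have := @flip_average _ N j (fun o => pointwise_risk z x Vhat (fun=> 0) (V o))
  (D ^+ 2 * p.[clamp (m * x - s - j%:R)] ^+ 2 / (8 * expR 1)) (fun o => pr0 _ _).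
rewrite (_ : _ / (8 * _) / 2 = D ^+ 2 * p.[clamp (m * x - s - j%:R)] ^+ 2 / (16 * expR 1));
  last by field; rewrite gt_eqF ?expR_gt0.
apply=> o; apply: le_trans (h o).
rewrite (_ : V o x - V (flip j o) x = bump_sum p N (bits D o) (m * x - s) -
      bump_sum p N (bits D (flip j o)) (m * x - s)) ?bump_sum_flip//.
by rewrite /V; ring.
Qed.

End flip_risk.

Section variance_lower_bound.
Context {R : realType}.
Local Notation mu := (@lebesgue_measure R).

(* [m] is of order [n ^ (1 / (1 + 2 b))]. *)
Lemma bandwidth (b : R) (n : nat) : 0 < b -> (0 < n)%N -> exists m : nat,
  [/\ (0 < m)%N, n%:R <= m%:R `^ (1 + 2 * b)
    & 2 `^ (- (2 * b)) * n%:R `^ (- (2 * b / (1 + 2 * b))) <= (m%:R `^ (- b)) ^+ 2].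
Proof.
move=> b0 n0; have n1 : 1 <= n%:R :> R by rewrite ler1n.
have nr0 : 0 < n%:R :> R by rewrite ltr0n.
pose g := n%:R `^ (1 + 2 * b)^-1.
have b1 : 0 < 1 + 2 * b by lra.
have b1n : 1 + 2 * b != 0 by rewrite gt_eqF.
have g1 : 1 <= g by rewrite /g -[leLHS](powRr0 n%:R) ler_powR// invr_ge0 ltW.
have g0 : 0 < g by lra.
exists (Num.truncn g).+1; split=> //.
  apply: (@le_trans _ _ (g `^ (1 + 2 * b))).
    by rewrite /g -powRrM mulVf// powRr1// ltW.
  by rewrite ge0_ler_powR ?nnegrE ?(ltW b1) ?(ltW g0)// ltW// truncnS_gt.
(* m <= g + 1 <= 2 g is the source of the factor 2^(-2 b). *)
have mg : (Num.truncn g).+1%:R <= 2 * g.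
  have := truncn_itv (ltW g0); rewrite -natr1 => /andP[h _]; lra.
have m0 : 0 < (Num.truncn g).+1%:R :> R by [].
rewrite -powR_mulrn ?powR_ge0// -powRrM.
have -> : - b * 2 = - (2 * b) by ring.
have -> : n%:R `^ (- (2 * b / (1 + 2 * b))) = g `^ (- (2 * b)).
  by rewrite /g -powRrM; congr (_ `^ _); ring.
rewrite -powRM ?(ltW g0)// !powRN lef_pV2 ?posrE ?powR_gt0 ?mulr_gt0//.
by rewrite ge0_ler_powR ?nnegrE ?mulr_ge0 ?(ltW b0) ?(ltW g0).
Qed.

Lemma variance_lower_bound (alpha beta Mf MV : R) : 0 < alpha -> 0 < beta ->
  0 < Mf -> 0 < MV ->
  exists2 C : R, 0 < C &
    forall (d : measure_display) (T : measurableType d) (P : probability T R)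
      (n : nat) (z : 'I_n -> {RV P >-> R}), (0 < n)%N -> iid_std_normal z ->
    ((C * n%:R `^ (- (2 * beta / (1 + 2 * beta))))%:E <=
       minimax (parameters alpha beta Mf MV) (global_risk z))%E /\
    forall xs : R, 0 < xs < 1 ->
      ((C * n%:R `^ (- (2 * beta / (1 + 2 * beta))))%:E <=
         minimax (parameters alpha beta Mf MV) (pointwise_risk z xs))%E.
Proof.
move=> alpha0 beta0 Mf0 MV0.
have [p [L [L0 [p0 p1 ph] pL bL class]]] := bump_Lipschitz_class beta0.
(* p climbs from 0 to 1 over [0, 1/2]. *)
have L2 : 2 <= L.
  have h0 : 0 <= (0 : R) <= 1 by rewrite lexx ler01.
  have := pL 0 (1 / 2) h0 half_itv; rewrite p0 ph !subr0 normr1 ger0_norm; lra.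
have e0 : 0 < expR 1 :> R by exact: expR_gt0.
pose A := MV / (8 * L).
have A0 : 0 < A by rewrite divr_gt0// mulr_gt0.
(* In 64 L, 16 comes from [flip_risk], 4 from using only p >= 1/2, and L from intervals of total
   length 1 / L. *)
pose C := A ^+ 2 * 2 `^ (- (2 * beta)) / (64 * expR 1 * L).
exists C.
  by apply: divr_gt0; [apply: mulr_gt0; rewrite ?exprn_gt0 ?powR_gt0|rewrite !mulr_gt0].
move=> d T P n z n0 iidz.
have [m [m0 nm ratem]] := bandwidth beta0 n0.
have m1 : 1 <= m%:R :> R by rewrite ler1n.
have mr0 : 0 < m%:R :> R by rewrite ltr0n.
pose D := A * m%:R `^ (- beta).
have D0 : 0 < D by rewrite mulr_gt0// powR_gt0.
pose V N s (o : {ffun 'I_N -> bool}) x := MV / 2 + bump_sum p N (bits D o) (m%:R * x - s).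
have inTheta N s (o : {ffun 'I_N -> bool}) :
    parameters alpha beta Mf MV ((fun=> 0), V N s o).
  split=> /=; first by apply: const_Lipschitz_class => //; rewrite normr0 ltW.
    apply: (class _ _ _ _ _ _ A) => //; first exact: ltW.
      by move=> k; apply: bits_bound; exact: ltW.
    rewrite gtr0_norm ?divr_gt0// /A (_ : MV / (8 * L) * L = MV / 8); first by lra.
    by field; rewrite gt_eqF.
  move=> x _; have := bL N (bits D o) D (fun k => bits_bound o k (ltW D0)) (m%:R * x - s).
  have DL : D * L <= MV / 8.
    rewrite /D /A (_ : _ * _ * L = MV / 8 * m%:R `^ (- beta)); last first.
      by field; rewrite gt_eqF.
    rewrite ler_piMr ?divr_ge0 ?(ltW MV0)// -[leRHS](powRr0 m%:R) ler_powR//.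
    by rewrite oppr_le0 ltW.
  by rewrite /V ler_norml => /andP[h1 h2]; lra.
have mV N s (o : {ffun 'I_N -> bool}) : measurable_fun setT (V N s o).
  by apply: measurable_funD => //; exact: measurable_bump_sum.
have risk N s := @flip_risk R beta p L MV beta0 L0 MV0 p0 p1 pL bL
  d T P n z N m%:R s n0 iidz m1 nm.
have w0 N (o : {ffun 'I_N -> bool}) : 0 <= 2^-1 ^+ N :> R by rewrite exprn_ge0.
have rateD : C * n%:R `^ (- (2 * beta / (1 + 2 * beta))) <= D ^+ 2 / (64 * expR 1 * L).
  rewrite /C mulrAC ler_pM2r ?invr_gt0 ?mulr_gt0// -[leLHS]mulrA /D.
  rewrite (exprMn 2 A (m%:R `^ (- beta))).
  by apply: ler_wpM2l ratem; exact: sqr_ge0.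
split; last first.
  move=> xs /andP[xs0 xs1].
  (* For the risk at [xs] a single bump is used, shifted to have its centre there. *)
  apply: (pointwise_minimax_ge (w0 1%N) (hypercube_weights 1)
    (inTheta 1%N (m%:R * xs - 1 / 2))) => Vhat mVhat.
  have x01 : xs \in `[0, 1] by rewrite in_itv/= !ltW.
  apply: le_trans (risk 1%N _ Vhat xs ord0 mVhat x01); rewrite lee_fin.
  apply: (le_trans rateD).
  have -> : m%:R * xs - (m%:R * xs - 1 / 2) - (ord0 : 'I_1)%:R = 1 / 2 by rewrite /=; ring.
  rewrite (clamp_id half_itv) ph expr1n mulr1 ler_pM2l ?exprn_gt0// lef_pV2 ?posrE ?mulr_gt0//.
  have h := ler_wpM2l (ltW e0) L2; clear -h e0; lra.
(* In bump coordinates, p >= 1 - L th = 1/2 within th of a centre; th <= 1/4 makes the intervals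
   [I j] disjoint and contained in [0, 1]. *)
pose th := (2 * L)^-1.
have th0 : 0 < th by rewrite invr_gt0 mulr_gt0.
have th4 : th <= 1 / 4 by rewrite /th -div1r ler_pdivrMr ?mulr_gt0//; clear -L2; lra.
pose lo (j : 'I_m) : R := (j%:R + 1 / 2 - th) / m%:R.
pose hi (j : 'I_m) : R := (j%:R + 1 / 2 + th) / m%:R.
pose I (j : 'I_m) : set (measurableTypeR R) := `[lo j, hi j]%classic.
have mI j : measurable (I j) by exact: measurable_itv.
pose c := D ^+ 2 / (64 * expR 1).
have c0 : 0 <= c by rewrite divr_ge0 ?sqr_ge0// mulr_ge0// ltW.
pose l (x : measurableTypeR R) : R := \sum_(j < m) c * \1_(I j) x.
have ml : measurable_fun (`[0%R, 1%R]%classic : set (measurableTypeR R)) l.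
  apply: measurable_funTS; apply: measurable_sum => j; apply: measurable_funM => //.
have l0 x : 0 <= l x by apply: sumr_ge0 => j _; rewrite mulr_ge0.
have IE j x : I j x -> `|m%:R * x - j%:R - 1 / 2| <= th.
  rewrite /I /= in_itv/= /lo /hi ler_pdivrMr// ler_pdivlMr// => /andP[h1 h2].
  by clear -h1 h2; rewrite ler_norml; apply/andP; split; lra.
have intl : (\int[mu]_(x in `[0%R, 1%R]) (l x)%:E = (D ^+ 2 / (64 * expR 1 * L))%:E)%E.
  under eq_integral do rewrite /l -sumEFin.
  rewrite ge0_integral_sum//; last 2 first.
  - move=> j; apply/measurable_EFinP; apply: measurable_funTS.
    exact: measurable_funM.
  - by move=> j x _; rewrite lee_fin mulr_ge0.
  rewrite (eq_bigr (fun=> (c * (2 * th / m%:R))%:E)); last first.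
    move=> j _; under eq_integral do rewrite EFinM.
    have mE : measurable_fun (`[0%R, 1%R]%classic : set (measurableTypeR R))
        (fun x : measurableTypeR R => (\1_(I j) x : R)%:E).
      by apply/measurable_EFinP; apply: measurable_funTS; exact: measurable_indic.
    have n0E (x : measurableTypeR R) : `[0%R, 1%R]%classic x -> (0 <= (\1_(I j) x : R)%:E)%E.
      by rewrite lee_fin.
    have cE : (0 <= c%:E)%E by rewrite lee_fin.
    rewrite (ge0_integralZl mu (measurable_itv _) mE n0E cE).
    have jm : j.+1%:R <= m%:R :> R by rewrite ler_nat.
    rewrite -natr1 in jm; have j0 : 0 <= j%:R :> R by [].
    have lo0 : 0 <= lo j by rewrite /lo divr_ge0 ?(ltW mr0)//; clear -j0 th4; lra.
    have hi1 : hi j <= 1 by rewrite /hi ler_pdivrMr//; clear -jm th4; lra.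
    rewrite integral_indic// (_ : I j `&` _ = I j); last first.
      apply/setIidPl => x; rewrite /I /= !in_itv/= => /andP[h1 h2].
      by rewrite (le_trans lo0 h1) (le_trans h2 hi1).
    have lohi : lo j < hi j.
      by rewrite /lo /hi ltr_pM2r ?invr_gt0//; clear -th0; lra.
    have := lebesgue_measure_itv (Interval (BLeft (lo j)) (BRight (hi j))).
    rewrite /= lte_fin lohi -EFinD => muI.
    apply: etrans (congr1 (fun t => c%:E * t)%E muI) _.
    rewrite -EFinM; congr EFin; rewrite /lo /hi.
    by field; rewrite gt_eqF.
  rewrite sumEFin; congr EFin; rewrite sumr_const card_ord -mulr_natr /c /th.
  by field; rewrite !gt_eqF.
apply: (@le_trans _ _ (\int[mu]_(x in `[0%R, 1%R]) (l x)%:E)%E).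
  by rewrite intl lee_fin.
apply: (global_minimax_ge (w0 m) (hypercube_weights m) (inTheta m 0) (mV m 0) ml l0).
move=> Vhat mVhat x x01.
have risk0 : (0 <= \sum_(o : {ffun 'I_m -> bool}) (2^-1 ^+ m)%:E *
    pointwise_risk z x Vhat (fun=> 0%R) (V m 0%R o))%E.
  apply: sume_ge0 => o _; rewrite mule_ge0 ?lee_fin ?w0//.
  by apply: integral_ge0 => t _; rewrite lee_fin sqr_ge0.
case: (pickP [pred j : 'I_m | `[< I j x >]]) => [j /asboolP Ij|noI]; last first.
  rewrite (_ : l x = 0)//; apply: big1 => j _.
  by rewrite indicE memNset ?mulr0// => Ij; have := noI j; rewrite /= (asboolT Ij).
have hj := IE j x Ij.
rewrite (_ : l x = c); last first.
  rewrite /l (bigD1 j)//= big1 ?addr0; first by rewrite indicE mem_set// mulr1.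
  move=> k kj; rewrite indicE memNset ?mulr0// => /IE.
  move: hj; rewrite !ler_norml => /andP[h1 h2] /andP[h3 h4].
  move: kj; rewrite neq_ltn => /orP[] kj.
    have : k.+1%:R <= j%:R :> R by rewrite ler_nat.
    by rewrite -natr1 => jk; clear -h1 h2 h3 h4 jk th4; lra.
  have : j.+1%:R <= k%:R :> R by rewrite ler_nat.
  by rewrite -natr1 => jk; clear -h1 h2 h3 h4 jk th4; lra.
apply: le_trans (risk m 0 Vhat x j mVhat x01); rewrite lee_fin subr0.
move: hj; set u := m%:R * x - j%:R => hj.
have /andP[u0 u1] : 0 <= u <= 1.
  move: hj; rewrite ler_norml => /andP[h1 h2].
  by clear -h1 h2 th4; apply/andP; split; lra.
rewrite clamp_id ?u0//.
have pu : 1 / 2 <= p.[u].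
  have hu : 0 <= u <= 1 by rewrite u0 u1.
  have := pL _ _ half_itv hu; rewrite ph => h.
  have : L * `|u - 1 / 2| <= L * th by rewrite ler_wpM2l// ltW.
  rewrite (_ : L * th = 1 / 2); last by rewrite /th; field; rewrite gt_eqF.
  by move=> h'; have := le_trans h h'; rewrite ler_norml => /andP[h3 _]; clear -h3; lra.
have pu2 : (1 / 2) ^+ 2 <= p.[u] ^+ 2.
  by rewrite lerXn2r// nnegrE ?divr_ge0// (le_trans _ pu)// divr_ge0.
rewrite /c (_ : D ^+ 2 / _ = D ^+ 2 * (1 / 2) ^+ 2 / (16 * expR 1)); last first.
  by field; rewrite gt_eqF.
rewrite ler_pM2r ?invr_gt0 ?mulr_gt0//.
by rewrite ler_wpM2l// sqr_ge0.
Qed.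

End variance_lower_bound.

Theorem theorem2 (R : realType) (alpha beta Mf MV : R)
    (halpha : 0 < alpha) (hbeta : 0 < beta) (hMf : 0 < Mf) (hMV : 0 < MV) :
  exists C1 : R, 0 < C1 /\
    forall (d : measure_display) (T : measurableType d) (P : probability T R)
      (n : nat) (z : 'I_n -> {RV P >-> R}),
      (0 < n)%N -> iid_std_normal z ->
      let rate := Num.max (n%:R `^ (- (4 * alpha)))
                          (n%:R `^ (- (2 * beta / (1 + 2 * beta)))) in
      let Theta := parameters alpha beta Mf MV in
      ((C1 * rate)%:E <= minimax Theta (global_risk z))%E /\
      forall xs : R, 0 < xs < 1 ->
        ((C1 * rate)%:E <= minimax Theta (pointwise_risk z xs))%E.
Proof.
have [Cv Cv0 hv] := variance_lower_bound halpha hbeta hMf hMV.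
have [alpha1|alpha1] := leP alpha 1.
  have a01 : 0 < alpha <= 1 by rewrite halpha.
  have [Cm Cm0 hm] := mean_lower_bound a01 hbeta hMf hMV.
  exists (Num.min Cm Cv); split; first by rewrite lt_min Cm0.
  move=> d T P n z n0 iidz; have [hvg hvp] := hv d T P n z n0 iidz.
  have [hmg hmp] := hm d T P n z n0 iidz; move=> rate Theta.
  have max_le M : ((Cm * n%:R `^ (- (4 * alpha)))%:E <= M)%E ->
      ((Cv * n%:R `^ (- (2 * beta / (1 + 2 * beta))))%:E <= M)%E ->
      ((Num.min Cm Cv * rate)%:E <= M)%E.
    rewrite /rate maxEle => h1 h2; case: ifP => _.
      by apply: le_trans h2; rewrite lee_fin ler_wpM2r ?powR_ge0// ge_min lexx orbT.
    by apply: le_trans h1; rewrite lee_fin ler_wpM2r ?powR_ge0// ge_min lexx.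
  by split=> [|xs xs01]; [exact: max_le hmg hvg|exact: max_le (hmp xs xs01) (hvp xs xs01)].
(* For alpha > 1, 2 beta / (1 + 2 beta) < 1 < 4 alpha, so the second term is the maximum. *)
exists Cv; split=> // d T P n z n0 iidz rate Theta.
suff -> : rate = n%:R `^ (- (2 * beta / (1 + 2 * beta))) by exact: hv.
apply/max_idPr; rewrite ler_powR ?ler1n// lerN2.
have b0 : 0 < 1 + 2 * beta by rewrite ltr_pwDl// mulr_ge0// ltW.
by rewrite ler_pdivrMr//; nra.
Qed.
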